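(* Let $H$ be a Hénon map of degree $d\geq2$ and let $G_H^+$ be its Green's function. Then for every $r>0$ the sublevel set \[ \Omega_r=\{(z,w)\in\mathbb{C}^2: G_H^+(z,w)<r\} \] is a Loewner Short $\mathbb{C}^2$.
   Context: A Hénon map is a map $H(z,w)=(p(z)+\delta w,\ z)$ of $\mathbb{C}^2$ where $p$ is a polynomial of degree $d\geq2$ and $\delta\neq0$. Its Green's function is $G_H^+(z,w)=\lim_{n\to\infty}\frac{1}{d^n}\log^+\|H^n(z,w)\|$, where $\log^+x=\max\{\log x,0\}$ and $H^n$ is the $n$-th iterate. Definition (Short $\mathbb{C}^k$): for $k\geq 2$, a domain $\Omega\subseteq\mathbb{C}^k$ is a Short $\mathbb{C}^k$ if it is the union of an increasing sequence of domains each biholomorphic to the unit ball of $\mathbb{C}^k$, its Kobayashi–Royden infinitesimal pseudometric vanishes identically, and it carries a non-constant plurisubharmonic function bounded above. Definition (Loewner): a Short $\mathbb{C}^k$ $\Omega$ is Loewner if there is a family of domains $\{\Omega_t\}_{t\geq0}$ with: (1) $\Omega=\bigcup_{t\geq0}\Omega_t$, and either every $\Omega_t$ is biholomorphic to the unit ball of $\mathbb{C}^k$ or every $\Omega_t$ is biholomorphic to the unit polydisc of $\mathbb{C}^k$; (2) $\Omega_t\subset\subset\Omega_s$ whenever $0\leq t<s$; (3) $\Omega_t=\bigcup_{t'<t}\Omega_{t'}$ for all $t>0$; (4) $\overline{\Omega_{t'}}=\bigcap_{t>t'}\Omega_t$ for all $t'\geq 0$. *)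

(* Defs.v *)
(* Complex numbers are mathcomp-real-closed's
   [R[i]] over an arbitrary [R : realType]; we use its regular normed-module copy
   [R[i]^o] so that it carries the canonical (complex) normed-space topology. *)
From HB Require Import structures.
From mathcomp Require Import all_boot all_order all_algebra.
From mathcomp Require Import complex.
From mathcomp Require Import all_classical all_reals all_analysis.
Import Order.TTheory GRing.Theory Num.Theory.
Import numFieldNormedType.Exports.

Set Implicit Arguments.
Unset Strict Implicit.
Unset Printing Implicit Defensive.

Local Open Scope classical_set_scope.
Local Open Scope ring_scope.
Local Open Scope complex_scope.

Notation CC R := ((R[i])^o).
Notation C2 R := ((R[i])^o * (R[i])^o)%type.

Definition cmod (R : realType) (z : R[i]) : R :=
  Num.sqrt (complex.Re z ^+ 2 + complex.Im z ^+ 2).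

Definition enorm (R : realType) (x : C2 R) : R :=
  Num.sqrt (complex.Re x.1 ^+ 2 + complex.Im x.1 ^+ 2 + complex.Re x.2 ^+ 2 + complex.Im x.2 ^+ 2).

Definition expi (R : realType) (t : R) : R[i] := cos t +i* sin t.

Definition log_plus (R : realType) (x : R) : R := Num.max (ln x) 0.

Definition henon (R : realType) (p : {poly R[i]}) (delta : R[i]) : C2 R -> C2 R :=
  fun x => (p.[x.1] + delta * x.2, x.1).

Definition henon_green (R : realType) (p : {poly R[i]}) (delta : R[i])
  (x : C2 R) : R :=
  limn (fun n : nat =>
          log_plus (enorm (iter n (henon p delta) x)) / ((size p).-1)%:R ^+ n).

Definition domain (R : realType) (A : set (C2 R)) : Prop :=
  open A /\ connected A /\ A !=set0.

Definition holomorphic_on (R : realType) (U V : normedModType (R[i]))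
  (f : U -> V) (A : set U) : Prop :=
  forall x, A x -> differentiable f x.

Definition biholomorphic (R : realType) (A B : set (C2 R)) : Prop :=
  exists (f g : C2 R -> C2 R),
    [/\ holomorphic_on f A, holomorphic_on g B,
        (forall x, A x -> B (f x) /\ g (f x) = x) &
        (forall y, B y -> A (g y) /\ f (g y) = y)].

Definition unit_disc (R : realType) : set (CC R) := [set z | cmod z < 1].
Definition unit_ball2 (R : realType) : set (C2 R) := [set x | enorm x < 1].
Definition unit_polydisc2 (R : realType) : set (C2 R) :=
  [set x | cmod x.1 < 1 /\ cmod x.2 < 1].

Definition kobayashi_royden (R : realType) (Omega : set (C2 R)) (p v : C2 R)
  : \bar R :=
  ereal_inf [set a%:E | a in
    [set a : R | 0 < a /\
      exists phi : CC R -> C2 R,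
        [/\ holomorphic_on phi (@unit_disc R),
            (forall z, unit_disc z -> Omega (phi z)),
            phi 0 = p &
            'D_1 phi 0 = (a^-1)%:C *: v]]].

Definition plurisubharmonic (R : realType) (Omega : set (C2 R))
  (u : C2 R -> \bar R) : Prop :=
  [/\ (forall x, Omega x -> u x != +oo%E),
      (forall x, Omega x -> forall c : R, (u x < c%:E)%E ->
          \forall y \near x, (u y < c%:E)%E) &
      (forall a b : C2 R,
          (forall z : CC R, cmod z <= 1 -> Omega (a + z *: b)%R) ->
          (u a <= ((2 * pi)^-1)%:E *
                  \int[@lebesgue_measure R]_(t in `[0%R, (2 * pi)%R])
                      u (a + (expi t : CC R) *: b)%R)%E)].

Definition short_C2 (R : realType) (Omega : set (C2 R)) : Prop :=
  [/\ domain Omega,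
      (exists Om : nat -> set (C2 R),
          [/\ (forall n, domain (Om n) /\ biholomorphic (@unit_ball2 R) (Om n)),
              (forall n, Om n `<=` Om n.+1) &
              Omega = \bigcup_n Om n]),
      (forall p v, Omega p -> kobayashi_royden Omega p v = 0%E) &
      (exists u : C2 R -> \bar R,
          [/\ plurisubharmonic Omega u,
              (exists M : R, forall x, Omega x -> (u x <= M%:E)%E) &
              (exists x y, [/\ Omega x, Omega y & u x != u y])])].

Definition rel_compact_in (R : realType) (A B : set (C2 R)) : Prop :=
  compact (closure A) /\ closure A `<=` B.

Definition loewner_short_C2 (R : realType) (Omega : set (C2 R)) : Prop :=
  short_C2 Omega /\
  exists Om : R -> set (C2 R),
    [/\ Omega = \bigcup_(t in [set t : R | 0 <= t]) Om t /\
        (forall t, 0 <= t -> domain (Om t)) /\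
        ((forall t, 0 <= t -> biholomorphic (@unit_ball2 R) (Om t)) \/
         (forall t, 0 <= t -> biholomorphic (@unit_polydisc2 R) (Om t))),
        (forall t s, 0 <= t -> t < s -> rel_compact_in (Om t) (Om s)),
        (forall t, 0 < t ->
            Om t = \bigcup_(t' in [set t' : R | 0 <= t' /\ t' < t]) Om t') &
        (forall t', 0 <= t' ->
            closure (Om t') = \bigcap_(t in [set t : R | t' < t]) Om t)].

(* Main.v *)
Require Import Defs.
(** With A such that |H x| <= A max(1,|x|)^d in the sup norm and c = ln A / (d - 1),
    the functions (log+ |H^n x| + c) / d^n decrease to G; hence G x < r holds iff
    |H^n x| < e^(d^n r - C) for some n, for every large C. So Omega_r is the
    increasing union of the preimages under H^n of balls (or of bidiscs) of radius
    rho_n = e^(d^n r - C), where rho_(n+1) = K rho_n^d with K as large as desired.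

    - Kobayashi: if G x < s < r, the tangent vector D(H^n)_x v is O(e^(d^n s)), which
      is o(rho_n), so the pullback by H^n of a complex line segment through H^n x gives
      arbitrarily large discs through x in the direction v.
    - Plurisubharmonicity: G is a decreasing limit of the functions above, so it is
      enough that log+ |q| is submean on the unit circle for a polynomial q. This is
      proved by iterating Graeffe's root squaring: the k-th iterate bounds 2^k times
      the circle mean of log+ |q| below by 2^k log |q(0)| + O(1).
    - Loewner: in the coordinates (z, w) = H^n x, the bidisc {|z|, |w| < rho_n} is
      deformed into H^-1 {|z|, |w| < rho_(n+1)} through the increasing domains
      {|z| < a, |s p(z) + delta w| < b}, which are all images of a bidisc by a shear. *)
From HB Require Import structures.
From mathcomp Require Import all_boot all_order all_algebra.
From mathcomp Require Import complex.
From mathcomp Require Import all_classical all_reals all_analysis.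
From mathcomp Require Import measurable_realfun.
From mathcomp Require Import ring lra.
Import Order.TTheory GRing.Theory Num.Theory.
Import numFieldNormedType.Exports.
Local Open Scope classical_set_scope.
Local Open Scope ring_scope.

Set Implicit Arguments.
Unset Strict Implicit.
Unset Printing Implicit Defensive.

(** * Complex modulus, sup norm and Euclidean norm on [C2 R], with their topology *)

Section Modulus.
Variable R : realType.
Implicit Types (z w : R[i]) (x y : C2 R).

Lemma normcE z : `|z| = real_complex R (cmod z).
Proof. exact: normc_def. Qed.

Lemma cmod_ge0 z : 0 <= cmod z.
Proof. exact: sqrtr_ge0. Qed.

Lemma cmod0 : cmod (0 : R[i]) = 0.
Proof. by rewrite /cmod /= expr0n addr0 sqrtr0. Qed.

Lemma cmod1 : cmod (1 : R[i]) = 1.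
Proof. by rewrite /cmod /= expr0n expr1n addr0 sqrtr1. Qed.

Lemma cmod_eq0 z : (cmod z == 0) = (z == 0).
Proof.
rewrite -[RHS]normr_eq0 normcE.
by rewrite -(inj_eq (@complexI R)).
Qed.

Lemma cmodM z w : cmod (z * w) = cmod z * cmod w.
Proof. by apply: (@complexI R); rewrite rmorphM /= -!normcE normrM. Qed.

Lemma cmodV z : cmod z^-1 = (cmod z)^-1.
Proof. by apply: (@complexI R); rewrite fmorphV /= -!normcE normfV. Qed.

Lemma cmodX z n : cmod (z ^+ n) = cmod z ^+ n.
Proof. by apply: (@complexI R); rewrite rmorphXn /= -!normcE normrX. Qed.

Lemma cmodN z : cmod (- z) = cmod z.
Proof. by apply: (@complexI R); rewrite -!normcE normrN. Qed.

Lemma cmodD z w : cmod (z + w) <= cmod z + cmod w.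
Proof. by rewrite -lecR rmorphD /= -!normcE ler_normD. Qed.

Lemma cmodB z w : cmod (z - w) <= cmod z + cmod w.
Proof. by rewrite -(cmodN w) cmodD. Qed.

Lemma cmodC z w : cmod (z - w) = cmod (w - z).
Proof. by rewrite -opprB cmodN. Qed.

Lemma ler_cmod_dist z w : cmod z - cmod w <= cmod (z - w).
Proof. by rewrite lerBlDr -{1}(subrK w z) cmodD. Qed.

Lemma ler_dist_cmod z w : `|cmod z - cmod w| <= cmod (z - w).
Proof. by rewrite ler_norml lerNl opprB ler_cmod_dist cmodC ler_cmod_dist. Qed.

Lemma cmod_real (r : R) : cmod (real_complex R r) = `|r|.
Proof. by rewrite /cmod /= expr0n addr0 sqrtr_sqr. Qed.

Lemma cmod_prod (I : Type) (s : seq I) (P : pred I) (F : I -> R[i]) :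
  cmod (\prod_(i <- s | P i) F i) = \prod_(i <- s | P i) cmod (F i).
Proof. exact: (big_morph _ cmodM cmod1). Qed.

Lemma cmod_sum (I : Type) (s : seq I) (P : pred I) (F : I -> R[i]) :
  cmod (\sum_(i <- s | P i) F i) <= \sum_(i <- s | P i) cmod (F i).
Proof.
elim/big_rec2 : _ => [|i u v _ H]; first by rewrite cmod0.
by rewrite (le_trans (cmodD _ _)) ?lerD2l.
Qed.

Lemma cmod_expi (t : R) : cmod (expi t) = 1.
Proof. by rewrite /cmod /= addrC sin2cos2 subrK sqrtr1. Qed.

Lemma normc_lt z (e : R) : (`|z| < real_complex R e) = (cmod z < e).
Proof. by rewrite normcE ltcR. Qed.

(** The balls of this norm are bidiscs. It is comparable to [enorm] up to a factor 2, which
    disappears in the limit defining the Green's function. *)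
Definition supn x : R := Num.max (cmod x.1) (cmod x.2).

Lemma supn_ge0 x : 0 <= supn x.
Proof. by rewrite le_max cmod_ge0. Qed.

Lemma supn_le x a : (supn x <= a) = (cmod x.1 <= a) && (cmod x.2 <= a).
Proof. by rewrite ge_max. Qed.

Lemma supn_lt x a : (supn x < a) = (cmod x.1 < a) && (cmod x.2 < a).
Proof. by rewrite gt_max. Qed.

Lemma cmod1_supn x : cmod x.1 <= supn x.
Proof. by rewrite le_max lexx. Qed.

Lemma cmod2_supn x : cmod x.2 <= supn x.
Proof. by rewrite le_max lexx orbT. Qed.

Lemma supnD x y : supn (x + y) <= supn x + supn y.
Proof.
by rewrite supn_le !(le_trans (cmodD _ _)) // lerD ?cmod1_supn ?cmod2_supn.
Qed.

Lemma supnZ (k : R[i]) x : supn (k *: x) = cmod k * supn x.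
Proof. by rewrite /supn /= !cmodM maxr_pMr ?cmod_ge0. Qed.

Lemma supn_enorm x : supn x <= enorm x.
Proof.
rewrite supn_le; apply/andP; split; apply: ler_wsqrtr;
  rewrite -addrA ?lerDl ?addr_ge0 ?sqr_ge0 //.
by rewrite lerDr addr_ge0 ?sqr_ge0.
Qed.

Lemma enorm_ge0 x : 0 <= enorm x.
Proof. exact: sqrtr_ge0. Qed.

Lemma sqr_enorm x : enorm x ^+ 2 = cmod x.1 ^+ 2 + cmod x.2 ^+ 2.
Proof. by rewrite !sqr_sqrtr ?addr_ge0 ?sqr_ge0 // !addrA. Qed.

Lemma enorm_supn x : enorm x <= 2 * supn x.
Proof.
rewrite -ler_sqr ?nnegrE ?mulr_ge0 ?supn_ge0 ?enorm_ge0 // sqr_enorm exprMn.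
have h1 : cmod x.1 ^+ 2 <= supn x ^+ 2.
  by rewrite ler_sqr ?nnegrE ?cmod_ge0 ?supn_ge0 ?cmod1_supn.
have h2 : cmod x.2 ^+ 2 <= supn x ^+ 2.
  by rewrite ler_sqr ?nnegrE ?cmod_ge0 ?supn_ge0 ?cmod2_supn.
have := sqr_ge0 (supn x); lra.
Qed.

Lemma enormZ (k : R[i]) x : enorm (k *: x) = cmod k * enorm x.
Proof.
apply/eqP; rewrite -(@eqrXn2 _ 2) ?mulr_ge0 ?enorm_ge0 ?cmod_ge0 //.
by rewrite exprMn !sqr_enorm /= !cmodM !exprMn mulrDr.
Qed.

Lemma near_cmod (z : CC R) (e : R) : 0 < e -> \forall w \near z, cmod (z - w) < e.
Proof.
move=> e0; apply/nbhs_ballP; exists (real_complex R e); first by rewrite /= ltcR.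
by move=> w; rewrite -ball_normE /= normc_lt.
Qed.

Lemma cvg_cmod (T : Type) (F : set_system T) (FF : Filter F) (f : T -> CC R)
    (l : CC R) :
  (forall e : R, 0 < e -> \forall x \near F, cmod (l - f x) < e) ->
  f x @[x --> F] --> l.
Proof.
(* The test radius is a positive element of [R[i]]; positivity forces its imaginary part to vanish,
   so real radii suffice. *)
move=> H; apply/cvgrPdist_lt => -[e1 e2]; rewrite ltcE /= => /andP[/eqP -> e0].
near=> x; rewrite -[_ < _]/(`|l - f x| < real_complex R e1) normc_lt.
by near: x; apply: H.
Unshelve. all: by end_near. Qed.

Lemma cmod_continuous : continuous (@cmod R : CC R -> R).
Proof.
move=> z; apply/(@cvgrPdist_lt R R _ (nbhs z)) => e e0; near=> w.
by apply: le_lt_trans (ler_dist_cmod _ _) _; near: w; apply: near_cmod.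
Unshelve. all: by end_near. Qed.

Lemma cmod_fst_continuous : continuous (fun x : C2 R => cmod x.1).
Proof.
by move=> x; apply: (continuous_comp (f := fst));
  [exact: cvg_fst|exact: cmod_continuous].
Qed.

Lemma cmod_snd_continuous : continuous (fun x : C2 R => cmod x.2).
Proof.
by move=> x; apply: (continuous_comp (f := snd));
  [exact: cvg_snd|exact: cmod_continuous].
Qed.

Lemma supn_continuous : continuous supn.
Proof.
move=> x; apply: (continuous_max (f := fun x : C2 R => cmod x.1)
    (g := fun x : C2 R => cmod x.2)).
- exact: cmod_fst_continuous.
- exact: cmod_snd_continuous.
Qed.

Lemma enorm_continuous : continuous (@enorm R).
Proof.
move=> x; rewrite (_ : @enorm R =
   (fun x => Num.sqrt (cmod x.1 * cmod x.1 + cmod x.2 * cmod x.2))); last first.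
  by apply/funext => y; rewrite -!expr2 -sqr_enorm sqrtr_sqr ger0_norm ?enorm_ge0.
apply: (@continuous_comp _ _ _ (fun x : C2 R => cmod x.1 * cmod x.1 + cmod x.2 * cmod x.2));
  last exact: sqrt_continuous.
apply: (@continuousD _ _ _ (fun x : C2 R => cmod x.1 * cmod x.1)
  (fun x : C2 R => cmod x.2 * cmod x.2)).
  by apply: continuousM; exact: cmod_fst_continuous.
by apply: continuousM; exact: cmod_snd_continuous.
Qed.

Lemma continuous_pair (T U V : topologicalType) (f : T -> U) (g : T -> V) :
  continuous f -> continuous g -> continuous (fun t => (f t, g t)).
Proof. by move=> cf cg t; apply: cvg_pair; [exact: cf|exact: cg]. Qed.

Lemma real_complex_continuous : continuous (real_complex R : R -> CC R).
Proof.
move=> t; apply: cvg_cmod => e e0; near=> u; rewrite -rmorphB cmod_real.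
near: u; have : (fun u : R => u) @ t --> t by exact: cvg_id.
by move/cvgr_dist_lt; apply.
Unshelve. all: by end_near. Qed.

(** A set that is star-shaped about 0 is a union of segments that all contain 0. *)
Lemma star_connected (A : set (C2 R)) :
  (forall x (s : R), A x -> 0 <= s <= 1 -> A (real_complex R s *: x)) ->
  connected A.
Proof.
move=> Astar.
have [->|/set0P[x0 Ax0]] := eqVneq A set0; first exact: connected0.
pose seg x := (fun s : R => real_complex R s *: x : C2 R) @` `[0, 1].
rewrite (_ : A = \bigcup_(x in A) seg x); last first.
  apply/seteqP; split => [x Ax|x [y Ay [s /= s01 <-]]]; last first.
    by apply: Astar => //; rewrite in_itv in s01.
  by exists x => //; exists 1; rewrite /= ?in_itv /= ?lexx ?ler01 // scale1r.
apply: bigcup_connected => [|x Ax].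
  exists 0 => x Ax; exists 0; rewrite /= ?in_itv /= ?lexx ?ler01 //.
  by rewrite scale0r.
apply: connected_continuous_connected; first exact: segment_connected.
apply: continuous_subspaceT => s.
have rc := @real_complex_continuous.
move: s; apply: continuous_pair => s.
  by apply: (@continuousM _ _ _ (cst x.1)); [exact: rc|exact: cvg_cst].
by apply: continuousM; [exact: rc|exact: cvg_cst].
Unshelve. all: by end_near. Qed.

(** The closed bidisc is a closed subset of the continuous image of the real cube of side [-a, a] in
    dimension four. *)
Lemma compact_supn_le (a : R) : compact [set x : C2 R | supn x <= a].
Proof.
pose f (x : (R * R) * (R * R)) : C2 R :=
  (complex.Complex x.1.1 x.1.2, complex.Complex x.2.1 x.2.2).
pose K := `[- a, a]%classic : set R.
have mkc : continuous (fun x : R * R => complex.Complex x.1 x.2 : CC R).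
  move=> t; apply: cvg_cmod => e e0.
  have e20 : 0 < e / 2 by rewrite divr_gt0.
  near=> u.
  have -> : complex.Complex t.1 t.2 - complex.Complex u.1 u.2 =
            real_complex R (t.1 - u.1) + complex.Complex 0 1 * real_complex R (t.2 - u.2).
    by apply/eqP; rewrite eq_complex /=; apply/andP; split; apply/eqP; ring.
  apply: le_lt_trans (cmodD _ _) _.
  rewrite cmodM !cmod_real /cmod /= expr0n add0r expr1n sqrtr1 mul1r.
  rewrite (splitr e); apply: ltrD.
    near: u; have : (fun u : R * R => u.1) @ t --> t.1 by exact: cvg_fst.
    by move/cvgr_dist_lt; apply.
  near: u; have : (fun u : R * R => u.2) @ t --> t.2 by exact: cvg_snd.
  by move/cvgr_dist_lt; apply.
have fc : continuous f.
  apply: continuous_pair => x.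
    apply: (continuous_comp (f := fst) (g := fun x : R * R => Complex x.1 x.2 : CC R)).
      exact: cvg_fst.
    exact: mkc.
  apply: (continuous_comp (f := snd) (g := fun x : R * R => Complex x.1 x.2 : CC R)).
    exact: cvg_snd.
  exact: mkc.
have cK : compact ((K `*` K) `*` (K `*` K)).
  by do 2![apply: compact_setX]; exact: segment_compact.
apply: (@subclosed_compact _ _ (f @` ((K `*` K) `*` (K `*` K)))).
- rewrite (_ : [set _ | _] = supn @^-1` [set t | t <= a]) //.
  by apply: closed_comp; [move=> x _; exact: supn_continuous|exact: closed_le].
- by apply: continuous_compact => //; exact: continuous_subspaceT.
- move=> [[z1 z2] [w1 w2]] /=; rewrite supn_le /= => /andP[h1 h2].
  exists ((z1, z2), (w1, w2)) => //=.
  have bnd u v : cmod (complex.Complex u v) <= a -> `|u| <= a /\ `|v| <= a.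
    move=> h; split; apply: le_trans h; rewrite -sqrtr_sqr; apply: ler_wsqrtr.
      by rewrite /= lerDl sqr_ge0.
    by rewrite /= lerDr sqr_ge0.
  have [? ?] := bnd _ _ h1; have [? ?] := bnd _ _ h2.
  by rewrite /K /= !in_itv /= -!ler_norml.
Unshelve. all: by end_near. Qed.

End Modulus.

(** * Change of variables for integrals over [0, 2 pi] *)

Section CircleMean.
Variable R : realType.
Local Notation mu := (@lebesgue_measure R).

Lemma continuous_itv_integrable (f : R -> R) (a b : R) :
  continuous f -> mu.-integrable `[a, b] (EFin \o f).
Proof.
move=> cf; apply: continuous_compact_integrable; first exact: segment_compact.
exact: continuous_subspaceT.
Qed.

Lemma Rintegral_affine (G : R -> R) (a b c e : R) : continuous G -> a <= b ->
  0 < c ->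
  \int[mu]_(x in `[c * a + e, c * b + e]) G x =
  c * \int[mu]_(x in `[a, b]) G (c * x + e).
Proof.
move=> cG ab c0; pose F (x : R) := c * x + e.
have dF (x : R) : is_derive x (1 : R) F c.
  have -> : F = (c *: (id : R -> R)) + cst e by [].
  by apply: is_derive_eq; rewrite addr0 /GRing.scale /= mulr1.
have F'E : derive1 F = cst c.
  by apply/funext => x; rewrite derive1E derive_val.
have cF : continuous F.
  by move=> x; apply/differentiable_continuous/derivable1_diffP.
have -> : c * \int[mu]_(x in `[a, b]) G (c * x + e) =
    \int[mu]_(x in `[a, b]) (c * G (F x)).
  rewrite RintegralZl //; apply: continuous_itv_integrable => x.
  by apply: continuous_comp; [exact: cF|exact: cG].
rewrite /Rintegral; congr fine.
rewrite -/(F a) -/(F b) (@integration_by_substitution_increasing _ F) //.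
- by apply: eq_integral => x _; rewrite /= F'E /cst /= mulrC.
- by move=> x y _ _ xy; rewrite /F ltrD2r ltr_pM2l.
- by rewrite F'E => x _; exact: cvg_cst.
- by rewrite F'E; exact: is_cvg_cst.
- by rewrite F'E; exact: is_cvg_cst.
- split=> [x _||].
  + exact: (@ex_derive _ _ _ _ _ _ _ (dF x)).
  + by apply: cvg_at_right_filter; exact: cF.
  + by apply: cvg_at_left_filter; exact: cF.
- exact: continuous_subspaceT.
Qed.

(** Angle doubling: as t runs over the half circle [0, pi], 2t runs once over the whole circle, and
    so do t and t + pi taken together. The left integral is thus 2 times that of g(2t) over
    [0, pi]. *)
Lemma Rintegral_doubling (f g : R -> R) : continuous f -> continuous g ->
  (forall t, g (2 * t) <= f t + f (t + pi)) ->
  \int[mu]_(t in `[0, 2 * pi]) g t <= 2 * \int[mu]_(t in `[0, 2 * pi]) f t.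
Proof.
move=> cf cg fg; have p0 := pi_gt0 R.
have fs : continuous (fun t : R => f (t + pi)).
  move=> t; apply: (@continuous_comp _ _ _ (fun t : R => t + pi) f);
    last exact: cf.
  by apply: continuousD; [exact: cvg_id|exact: cvg_cst].
have cg2 : continuous (fun t : R => g (2 * t + 0)).
  move=> t; apply: (@continuous_comp _ _ _ (fun t : R => 2 * t + 0) g).
    apply: continuousD; last exact: cvg_cst.
    by apply: continuousM; [exact: cvg_cst|exact: cvg_id].
  exact: cg.
have cfs : continuous (fun t : R => f t + f (t + pi)).
  by move=> t; apply: continuousD; [exact: cf|exact: fs].
have -> : \int[mu]_(t in `[0, 2 * pi]) f t =
    \int[mu]_(t in `[0, pi]) (f t + f (t + pi)).
  rewrite RintegralD //; [|exact: continuous_itv_integrable..].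
  have := @Rintegral_itvB _ f (BLeft 0) (BRight (2 * pi)) pi
    (continuous_itv_integrable _ _ cf).
  rewrite !bnd_simp => /(_ (ltW p0)); rewrite ler_peMl ?ltW ?ltr1n // => /(_ isT).
  rewrite Rintegral_itv_obnd_cbnd; last first.
    apply: integrableS (continuous_itv_integrable pi (2 * pi) cf) => //.
    by apply: subset_itvr; rewrite bnd_simp.
  move/eqP; rewrite subr_eq => /eqP ->; rewrite addrC; congr (_ + _).
  have := @Rintegral_affine f 0 pi 1 pi cf (ltW p0) ltr01.
  rewrite mulr0 add0r mul1r -mulr2n -(mulr_natl pi) mul1r => ->.
  by apply: eq_Rintegral => t _; rewrite mul1r.
have := @Rintegral_affine g 0 pi 2 0 cg (ltW p0) (ltr0n _ _).
rewrite mulr0 !addr0 => ->; rewrite ler_pM2l //.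
apply: le_Rintegral => //.
- exact: continuous_itv_integrable.
- exact: continuous_itv_integrable.
- by move=> t _; rewrite addr0.
Qed.

End CircleMean.

(** * Elementary estimates for log+ *)

Section LogPlus.
Variable R : realType.
Implicit Types x y : R.

Lemma log_plusE x : log_plus x = ln (Num.max 1 x).
Proof.
rewrite /log_plus; case: (leP 1 x) => x1; first by rewrite max_l // ln_ge0.
(* For x <= 0 the default value [ln x = 0] makes both sides vanish. *)
rewrite ln1 max_r //; have [x0|x0] := ltP 0 x; last by rewrite ln0.
by rewrite ln_le0 // ltW.
Qed.

Lemma log_plus_ge0 x : 0 <= log_plus x.
Proof. by rewrite le_max lexx orbT. Qed.

Lemma ln_le_log_plus x : ln x <= log_plus x.
Proof. by rewrite le_max lexx. Qed.

Let max1_gt0 x : 0 < Num.max 1 x.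
Proof. by rewrite lt_max ltr01. Qed.

Lemma expR_log_plus x : expR (log_plus x) = Num.max 1 x.
Proof. by rewrite log_plusE lnK // posrE. Qed.

Lemma log_plus_ler x y : (log_plus x <= y) = (Num.max 1 x <= expR y).
Proof. by rewrite -ler_expR expR_log_plus. Qed.

Lemma log_plus_ltr x y : (log_plus x < y) = (Num.max 1 x < expR y).
Proof. by rewrite -ltr_expR expR_log_plus. Qed.

Lemma log_plus_homo x y : x <= y -> log_plus x <= log_plus y.
Proof.
move=> xy; rewrite log_plus_ler expR_log_plus.
by rewrite ge_max le_max lexx /= le_max xy orbT.
Qed.

Lemma log_plusM x y : 0 <= x -> 0 <= y ->
  log_plus (x * y) <= log_plus x + log_plus y.
Proof.
move=> x0 y0; rewrite log_plus_ler expRD !expR_log_plus.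
rewrite ge_max -{1}[1]mulr1 !ler_pM ?le_max ?lexx ?orbT //.
Qed.

(** After exponentiation this is max(1, x) <= max(1, y) e^|x - y|, which follows from e^u >= 1 + u
    and max(1, y) >= 1. *)
Lemma log_plus_lipschitz x y : log_plus x <= log_plus y + `|x - y|.
Proof.
rewrite log_plus_ler expRD expR_log_plus.
have := expR_ge1Dx `|x - y|; have := ler_norm (x - y).
have := normr_ge0 (x - y).
set n := `|_|; set e := expR _; set m := Num.max 1 y => n0 xy ne.
have m1 : 1 <= m by rewrite le_max lexx.
have my : y <= m by rewrite le_max lexx orbT.
have : 0 <= (e - (1 + n)) * m by rewrite mulr_ge0 //; lra.
have : 0 <= n * (m - 1) by rewrite mulr_ge0 //; lra.
by move=> h1 h2; rewrite ge_max; apply/andP; split; lra.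
Qed.

Lemma log_plus_continuous : continuous (@log_plus R).
Proof.
move=> x; rewrite (_ : @log_plus R = (fun x => ln (Num.max 1 x))); last first.
  by apply/funext => y; rewrite log_plusE.
apply: (@continuous_comp _ _ _ (fun x => Num.max 1 x) (@ln R)).
  by apply: (continuous_max (f := cst 1) (g := id)); [exact: cvg_cst|exact: cvg_id].
exact: continuous_ln.
Qed.

End LogPlus.

(** * Circle means of log+ |q| and root squaring *)

Section Submean.
Variable R : realType.
Local Notation mu := (@lebesgue_measure R).
Implicit Types (q : {poly R[i]}) (z a : R[i]).

Lemma horner_continuous q : continuous (fun z : CC R => q.[z] : CC R).
Proof.
elim/poly_ind: q => [|q c IH] z.
  rewrite (_ : (fun _ => _) = cst (0 : CC R)); first exact: cst_continuous.
  by apply/funext => x; rewrite horner0.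
rewrite (_ : (fun _ => _) = (fun x : CC R => q.[x] * x + c : CC R)); last first.
  by apply/funext => x; rewrite hornerMXaddC.
apply: (@continuousD _ _ _ (fun x : CC R => q.[x] * x : CC R) (cst c));
  last exact: cst_continuous.
apply: (@continuousM _ _ (fun x : CC R => q.[x] : CC R) id); last by move=> ?.
exact: IH.
Qed.

Lemma expi_continuous : continuous (@expi R : R -> CC R).
Proof.
move=> t; apply: cvg_cmod => e e0; have e20 : 0 < e / 2 by rewrite divr_gt0.
near=> u.
have -> : expi t - expi u =
  real_complex R (cos t - cos u) + Complex 0 1 * real_complex R (sin t - sin u).
  by apply/eqP; rewrite eq_complex /=; apply/andP; split; apply/eqP; ring.
apply: le_lt_trans (cmodD _ _) _.
rewrite cmodM !cmod_real /cmod /= expr0n add0r expr1n sqrtr1 mul1r (splitr e).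
apply: ltrD.
  near: u; have := @continuous_cos R t.
  by move/cvgr_dist_lt; apply.
near: u; have := @continuous_sin R t.
by move/cvgr_dist_lt; apply.
Unshelve. all: by end_near. Qed.

Lemma expiDpi (t : R) : expi (t + pi) = - expi t.
Proof. by rewrite /expi cosDpi sinDpi. Qed.

Lemma expi2 (t : R) : expi (2 * t) = expi t ^+ 2.
Proof.
rewrite /expi mulr_natl mulr2n cosD sinD expr2.
by apply/eqP; rewrite eq_complex /= eqxx /=; apply/eqP; ring.
Qed.

Lemma log_plus_circle_continuous q :
  continuous (fun t : R => log_plus (cmod q.[expi t])).
Proof.
move=> t; apply: (@continuous_comp _ _ _ (fun t => cmod q.[expi t]) (@log_plus R));
  last exact: log_plus_continuous.
apply: (@continuous_comp _ _ _ (fun t => q.[expi t] : CC R) (@cmod R));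
  last exact: cmod_continuous.
apply: (@continuous_comp _ _ _ (@expi R : R -> CC R) (fun z : CC R => q.[z] : CC R)).
  exact: expi_continuous.
exact: horner_continuous.
Qed.

(** With log+ in place of log the integrand stays continuous even when q vanishes on the circle, so
    no improper integral arises. *)
Definition circle_mean q : R :=
  (2 * pi)^-1 * \int[mu]_(t in `[0, 2 * pi]) log_plus (cmod q.[expi t]).

Let twopi_gt0 : 0 < 2 * pi :> R.
Proof. by rewrite mulr_gt0 // pi_gt0. Qed.

Let integrable_log q :
  mu.-integrable `[0, 2 * pi] (EFin \o (fun t => log_plus (cmod q.[expi t]))).
Proof. exact/continuous_itv_integrable/log_plus_circle_continuous. Qed.

Lemma circle_mean_cst (c : R) :
  (2 * pi)^-1 * \int[mu]_(t in `[0, 2 * pi]) c = c.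
Proof.
rewrite Rintegral_cst //= lebesgue_measure_itv /= lte_fin twopi_gt0.
by rewrite ?EFinN ?sube0 /= ?subr0 mulrCA mulVf ?mulr1 // gt_eqF.
Qed.

Lemma le_circle_mean_cst q (c : R) :
  (forall t, c <= log_plus (cmod q.[expi t])) -> c <= circle_mean q.
Proof.
move=> H; rewrite -[leLHS]circle_mean_cst ler_pM2l ?invr_gt0 //.
apply: le_Rintegral => //.
by apply: continuous_itv_integrable; exact: cst_continuous.
Qed.

Lemma le_circle_meanD q q' (c : R) :
  (forall t, log_plus (cmod q.[expi t]) <= log_plus (cmod q'.[expi t]) + c) ->
  circle_mean q <= circle_mean q' + c.
Proof.
move=> H; rewrite -[X in _ <= _ + X]circle_mean_cst /circle_mean -mulrDr.
have ci : mu.-integrable `[0, 2 * pi] (EFin \o cst c).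
  by apply: continuous_itv_integrable; exact: cst_continuous.
rewrite ler_pM2l ?invr_gt0 // -RintegralD //.
apply: le_Rintegral => //; apply: continuous_itv_integrable => t.
apply: (@continuousD _ _ _ (fun t => log_plus (cmod q'.[expi t])) (cst c)).
  exact: log_plus_circle_continuous.
exact: cvg_cst.
Qed.

(** Recording a polynomial by its leading coefficient and its roots with multiplicity turns root
    squaring into squaring of [c] and of each entry of [s]. *)
Definition root_poly (c : R[i]) (s : seq R[i]) : {poly R[i]} :=
  c *: \prod_(a <- s) ('X - a%:P).

Lemma horner_root_poly c s z : (root_poly c s).[z] = c * \prod_(a <- s) (z - a).
Proof.
rewrite /root_poly hornerZ horner_prod; congr (_ * _).
by apply: eq_bigr => a _; rewrite hornerXsubC.
Qed.

(* Graeffe's root squaring: P(z) P(-z) is, up to sign, the value at z^2 of the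
   polynomial with squared roots. *)
Lemma circle_mean_graeffe c s :
  circle_mean (root_poly (c ^+ 2) [seq a ^+ 2 | a <- s]) <=
  2 * circle_mean (root_poly c s).
Proof.
rewrite /circle_mean mulrCA ler_pM2l ?invr_gt0 //.
apply: Rintegral_doubling; [exact: log_plus_circle_continuous..|move=> t].
apply: le_trans (log_plusM (cmod_ge0 _) (cmod_ge0 _)).
apply: log_plus_homo.
rewrite -cmodM !horner_root_poly expi2 expiDpi big_map mulrACA -expr2.
rewrite cmodM [leRHS]cmodM ler_wpM2l ?cmod_ge0 // -big_split /= !cmod_prod.
rewrite le_eqVlt; apply/orP; left; apply/eqP; apply: eq_bigr => a _.
rewrite -[RHS]cmodN; congr cmod; ring.
Qed.

Lemma circle_mean_graeffe_iter k c s :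
  circle_mean (root_poly (c ^+ (2 ^ k)) [seq a ^+ (2 ^ k) | a <- s]) <=
  2 ^+ k * circle_mean (root_poly c s).
Proof.
elim: k c s => [|k IH] c s.
  by rewrite expn0 expr1 expr0 mul1r (eq_map (g := id)) ?map_id // => a.
rewrite expnS exprM (eq_map (g := fun a => (a ^+ 2) ^+ (2 ^ k))); last first.
  by move=> a; rewrite exprM.
rewrite (map_comp (fun a => a ^+ (2 ^ k)) (fun a => a ^+ 2)).
rewrite (le_trans (IH _ _)) // [leRHS](_ : _ = 2 ^+ k * (2 * circle_mean (root_poly c s))) ?ler_pM2l ?exprn_gt0 //.
  exact: circle_mean_graeffe.
by rewrite [in LHS]exprSr mulrA.
Qed.

End Submean.

(** * A Jensen inequality for polynomials, and the submean property of log+ |q| *)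

Section Jensen.
Variable R : realType.
Implicit Types (q : {poly R[i]}) (z a : R[i]).

(** The constant does not depend on N. If |a| < 1, then |z - a^N| >= 1 - |a|^N >= 1 - |a|; if |a| >
    1, then |z - a^N| >= |a|^N - 1 >= (1 - 1/|a|) |a|^N. *)
Lemma sep_root_power a : a != 0 -> cmod a != 1 ->
  exists2 kappa : R, 0 < kappa & forall N z, (0 < N)%N -> cmod z = 1 ->
    kappa * cmod a ^+ N <= cmod (z - a ^+ N).
Proof.
move=> a0 a1; have r0 : 0 < cmod a by rewrite lt_neqAle cmod_ge0 eq_sym cmod_eq0 a0.
have [ra|ra] := ltP (cmod a) 1.
  exists (1 - cmod a) => [|[//|N] z _ z1]; first by rewrite subr_gt0.
  have := ler_cmod_dist z (a ^+ N.+1); rewrite z1 cmodX; apply: le_trans.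
  have rN : cmod a ^+ N <= 1 by rewrite exprn_ile1 // ltW.
  have rN0 : 0 <= cmod a ^+ N by rewrite exprn_ge0 // ltW.
  rewrite exprS; set r := cmod a in r0 ra rN rN0 *; set u := r ^+ N in rN rN0 *.
  have : 0 <= r * (1 - u) by rewrite mulr_ge0 ?subr_ge0 // ltW.
  have : 0 <= (1 - r) * (1 - r * u).
    by rewrite mulr_ge0 ?subr_ge0 ?mulr_ile1 // ltW.
  by lra.
have {}ra : 1 < cmod a by rewrite lt_neqAle eq_sym a1.
exists (1 - (cmod a)^-1) => [|[//|N] z _ z1].
  by rewrite subr_gt0 invf_lt1.
rewrite cmodC; have := ler_cmod_dist (a ^+ N.+1) z; rewrite z1 cmodX; apply: le_trans.
by rewrite mulrBl mul1r exprS mulKf ?gt_eqF // lerB // exprn_ege1 // ltW.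
Qed.

Lemma sep_roots_power (s : seq R[i]) : (forall a, a \in s -> a != 0 /\ cmod a != 1) ->
  exists2 K : R, 0 < K & forall N z, (0 < N)%N -> cmod z = 1 ->
    K * (\prod_(a <- s) cmod a) ^+ N <= cmod (\prod_(a <- s) (z - a ^+ N)).
Proof.
elim: s => [_|a s IH H].
  by exists 1 => // N z _ _; rewrite !big_nil expr1n mul1r cmod1.
have [|K K0 HK] := IH; first by move=> b bs; apply: H; rewrite inE bs orbT.
have [a0 a1] := H a (mem_head _ _).
have [k k0 Hk] := sep_root_power a0 a1.
exists (k * K) => [|N z N0 z1]; first exact: mulr_gt0.
rewrite !big_cons cmodM exprMn mulrACA ler_pM ?Hk ?HK //.
  by rewrite mulr_ge0 ?exprn_ge0 ?cmod_ge0 // ltW.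
by rewrite mulr_ge0 ?exprn_ge0 ?prodr_ge0 ?ltW // => i _; rewrite cmod_ge0.
Qed.

(** Up to sign, c times the product of the roots is the value at 0. Root squaring k times gives ln K
    + 2^k ln m <= 2^k J, with K independent of k, so K is negligible after division by 2^k. *)
Lemma jensen_off_circle c (s : seq R[i]) : c * \prod_(a <- s) a != 0 ->
  (forall a, a \in s -> cmod a != 1) ->
  ln (cmod (c * \prod_(a <- s) a)) <= circle_mean (root_poly c s).
Proof.
rewrite mulf_eq0 negb_or => /andP[c0 s0] s1.
have [|K K0 HK] := @sep_roots_power s.
  move=> a sa; split; last exact: s1.
  apply: contraNneq s0 => a0; rewrite prodf_seq_eq0; apply/hasP; exists a => //=.
  exact/eqP.
set m := cmod _; set J := circle_mean _.
have m0 : 0 < m.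
  by rewrite lt_neqAle cmod_ge0 eq_sym cmod_eq0 mulf_neq0.
have key k : ln K + 2 ^+ k * ln m <= 2 ^+ k * J.
  apply: le_trans (circle_mean_graeffe_iter k c s); apply: le_circle_mean_cst => t.
  apply: le_trans (ln_le_log_plus _).
  have -> : 2 ^+ k * ln m = ln (m ^+ (2 ^ k)).
    by rewrite lnXn // -(mulr_natl (ln m)) natrX.
  rewrite -lnM ?posrE ?exprn_gt0 //.
  have h : K * m ^+ (2 ^ k) <= cmod (root_poly (c ^+ (2 ^ k))
       [seq a ^+ (2 ^ k) | a <- s]).[expi t].
    rewrite horner_root_poly big_map cmodM cmodX /m cmodM cmod_prod exprMn mulrCA.
    by rewrite ler_wpM2l ?exprn_ge0 ?cmod_ge0 // HK ?expn_gt0 ?cmod_expi.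
  have h0 : 0 < K * m ^+ (2 ^ k) by rewrite mulr_gt0 // exprn_gt0.
  by rewrite ler_ln ?posrE // (lt_le_trans h0).
rewrite leNgt; apply/negP => Jm; pose d := ln m - J.
have d0 : 0 < d by rewrite subr_gt0.
(* If J < ln m, then [key] bounds 2^k d by - ln K for every k, which fails for large k. *)
have [k] : exists k : nat, - ln K / d < 2 ^+ k.
  pose n := Num.bound `|- ln K / d|; exists n.
  apply: le_lt_trans (ler_norm _) _.
  apply: lt_trans (archi_boundP (normr_ge0 _)) _.
  by rewrite -/n -natrX ltr_nat; exact: ltn_expl.
rewrite ltr_pdivrMr // /d; have := key k; set u := 2 ^+ k; lra.
Qed.

(** The bound and the Lipschitz estimate go through the induction together: the difference for q X +
    c contains the term q(rho z) z (1 - rho), which needs a bound on q(rho z). *)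
Lemma horner_scale_lipschitz q : exists M : R, 0 <= M /\
  forall (rho : R) z, 0 <= rho <= 1 -> cmod z <= 1 ->
    cmod q.[z] <= M /\
    cmod (q.[z] - q.[real_complex R rho * z]) <= M * (1 - rho).
Proof.
elim/poly_ind: q => [|q c [M [M0 IH]]].
  by exists 0; split=> // rho z _ _; rewrite !horner0 subrr mul0r cmod0.
exists (M + M + cmod c); split=> [|rho z rho01 z1]; first by rewrite !addr_ge0 ?cmod_ge0.
have [h1 h2] := IH rho z rho01 z1; case/andP: rho01 => r0 r1.
(* The induction hypothesis is reused at the point rho z, with scale 1. *)
have [h3 _] : cmod q.[real_complex R rho * z] <= M /\ True.
  split=> //; have [] := IH 1 (real_complex R rho * z) => //.
    by rewrite ler01 lexx.
  by rewrite cmodM cmod_real ger0_norm // mulr_ile1 ?cmod_ge0.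
rewrite !hornerMXaddC; split.
  apply: le_trans (cmodD _ _) _; rewrite lerD2r cmodM.
  have : cmod q.[z] * cmod z <= M * 1 by rewrite ler_pM ?cmod_ge0.
  by lra.
set u := q.[z] in h1 h2 *; set v := q.[_] in h2 h3 *.
have -> : u * z + c - (v * (real_complex R rho * z) + c) =
  (u - v) * z + v * z * real_complex R (1 - rho) by rewrite rmorphB rmorph1; ring.
apply: le_trans (cmodD _ _) _; rewrite !cmodM cmod_real ger0_norm ?subr_ge0 //.
have r1' : 0 <= 1 - rho by rewrite subr_ge0.
have : cmod (u - v) * cmod z <= M * (1 - rho) * 1.
  by rewrite ler_pM ?cmod_ge0.
have : cmod v * cmod z * (1 - rho) <= M * 1 * (1 - rho).
  by rewrite ler_wpM2r // ler_pM ?cmod_ge0.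
have := mulr_ge0 (cmod_ge0 c) r1'; lra.
Qed.

(** With m < 1 at least 1 - e and at least every member of [s] below 1, the midpoint of m and 1
    avoids [s]. *)
Lemma radius_avoiding (s : seq R) (e : R) : 0 < e ->
  exists rho : R, [/\ 0 < rho, rho < 1, 1 - rho <= e & rho \notin s].
Proof.
move=> e0; have [m [m0 m1 me H]] : exists m : R, [/\ 0 <= m, m < 1, 1 - m <= e &
    forall x, x \in s -> x < 1 -> x <= m].
  elim: s => [|x s [m [m0 m1 me IH]]].
    exists (Num.max 0 (1 - e)); split=> //; rewrite ?le_max ?lexx //.
      by rewrite gt_max ltr01 /= ltrBlDr ltrDl.
    by rewrite lerBlDr -lerBlDl le_max lexx orbT.
  have [x1|x1] := ltP x 1; last first.
    exists m; split=> // b; rewrite inE => /predU1P[->|/IH //].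
    by rewrite ltNge x1.
  exists (Num.max m x); split.
  - by rewrite le_max m0.
  - by rewrite gt_max m1.
  - by rewrite (le_trans _ me) // lerB // le_max lexx.
  move=> b; rewrite inE => /predU1P[->|/IH h /h]; rewrite le_max ?lexx ?orbT //.
  by move=> ->.
exists ((m + 1) / 2); split; [lra..|].
by apply/negP => /H; lra.
Qed.

(** Roots on the unit circle are moved off it by passing to q(rho z) with rho < 1 close to 1. This
    keeps the value at 0 and changes the circle mean by at most M (1 - rho). *)
Lemma submean_poly q : log_plus (cmod q.[0]) <= circle_mean q.
Proof.
have [q1|q1] := leP (cmod q.[0]) 1.
  rewrite [leLHS](_ : _ = 0).
    by apply: le_circle_mean_cst => t; exact: log_plus_ge0.
  by rewrite log_plusE max_l // ln1.
have -> : log_plus (cmod q.[0]) = ln (cmod q.[0]).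
  by rewrite log_plusE max_r // ltW.
have [M [M0 HM]] := horner_scale_lipschitz q.
have [s qE] := closed_field_poly_normal q.
(* The tolerance e / (M + 1) keeps the error M e' below e, and its denominator is positive even if M
   = 0. *)
set c := lead_coef q in qE.
apply/ler_addgt0Pr => e e0; pose e' := e / (M + 1).
have e'0 : 0 < e' by rewrite divr_gt0 // ltr_wpDl.
have [rho [r0 r1 re rs]] := @radius_avoiding [seq cmod a | a <- s] e' e'0.
pose rc := real_complex R rho.
have rc0 : rc != 0 by rewrite -cmod_eq0 cmod_real normr_eq0 gt_eqF.
(* These are the roots and the leading coefficient of q(rho z). *)
pose s' := [seq a / rc | a <- s]; pose c' := c * rc ^+ size s.
have q'E z : (root_poly c' s').[z] = q.[rc * z].
  rewrite [in RHS]qE -/(root_poly c s) !horner_root_poly /c' -mulrA; congr (_ * _).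
  rewrite /s' big_map {qE s' c' rs}; elim: s => [|a s IH].
    by rewrite !big_nil mulr1.
  rewrite !big_cons -IH exprS mulrACA; congr (_ * _).
  by rewrite mulrBr mulrCA divff // mulr1.
have q'0 : cmod (c' * \prod_(a <- s') a) = cmod q.[0].
  rewrite -[in RHS](mulr0 rc) -q'E horner_root_poly !cmodM; congr (_ * _).
  by rewrite !cmod_prod; apply: eq_bigr => a _; rewrite sub0r cmodN.
have := @jensen_off_circle c' s'; rewrite q'0 => H.
have {}H : ln (cmod q.[0]) <= circle_mean (root_poly c' s').
  apply: H.
    by rewrite -cmod_eq0 q'0 gt_eqF // (lt_trans ltr01).
  move=> _ /mapP[a sa ->]; rewrite cmodM cmodV cmod_real gtr0_norm //.
  apply: contraNneq rs => /(canRL (mulfVK (lt0r_neq0 r0))); rewrite mul1r => <-.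
  exact: map_f.
apply: (le_trans H); apply: le_circle_meanD => t; rewrite q'E.
apply: le_trans (log_plus_lipschitz _ (cmod q.[expi t])) _; rewrite lerD2l.
rewrite distrC; apply: le_trans (ler_dist_cmod _ _) _.
have [||_ h] := HM rho (expi t); first by rewrite !ltW.
  by rewrite cmod_expi.
apply: (le_trans h).
have : M * (1 - rho) <= M * e' by rewrite ler_wpM2l.
have : (M + 1) * e' = e by rewrite /e' mulrC divfK // gt_eqF // ltr_wpDl.
by lra.
Qed.

End Jensen.

(** * Differentials of projections and polynomials; growth of polynomials *)

Section Holomorphy.
Variable R : realType.
Implicit Types (q : {poly R[i]}).

(** Packed as a linear map, a continuous projection is its own differential. *)
Lemma is_diff_fst (x : C2 R) : is_diff x (fun y : C2 R => y.1) (fun y : C2 R => y.1).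
Proof.
have c : continuous (fst : C2 R -> CC R) by move=> y; exact: cvg_fst.
have l : linear (fst : C2 R -> CC R) by [].
pose L := GRing.isLinear.Build _ _ _ _ _ l.
pose F : {linear _ -> _} := HB.pack (fst : C2 R -> CC R) L.
have cF : continuous F by [].
by apply: DiffDef; [exact: (linear_differentiable _ cF)|exact: (diff_lin _ cF)].
Qed.

Lemma is_diff_snd (x : C2 R) : is_diff x (fun y : C2 R => y.2) (fun y : C2 R => y.2).
Proof.
have c : continuous (snd : C2 R -> CC R) by move=> y; exact: cvg_snd.
have l : linear (snd : C2 R -> CC R) by [].
pose L := GRing.isLinear.Build _ _ _ _ _ l.
pose F : {linear _ -> _} := HB.pack (snd : C2 R -> CC R) L.
have cF : continuous F by [].
by apply: DiffDef; [exact: (linear_differentiable _ cF)|exact: (diff_lin _ cF)].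
Qed.

Lemma is_diff_horner (V : normedModType R[i]) q (f df : V -> CC R) (x : V) :
  is_diff x f df ->
  is_diff x (fun y => q.[f y] : CC R) (fun h => q^`().[f x] * df h : CC R).
Proof.
move=> dfx; elim/poly_ind: q => [|q c IH].
  rewrite (_ : (fun y => _) = cst (0 : CC R)); last first.
    by apply/funext => y; rewrite horner0.
  apply: is_diff_eq; apply/funext => h.
  by rewrite deriv0 horner0 mul0r.
rewrite (_ : (fun y => _) = ((fun y => q.[f y] : CC R) * f + cst (c : CC R))).
  have h1 := @is_diffM _ _ _ _ _ _ x IH dfx.
  have h2 := @is_diffD _ _ _ _ _ _ _ x h1 (@is_diff_cst _ _ _ (c : CC R) x).
  apply: (@is_diff_eq _ _ _ _ _ _ x h2); apply/funext => h /=.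
  rewrite derivD derivC addr0 derivM derivX mulr1 !hornerD hornerMX horner0.
  rewrite !fctE /GRing.scale /=; ring.
by apply/funext => y; rewrite hornerMXaddC.
Qed.

(** The constant is the sum of the moduli of the coefficients; rho >= 1 lets rho^n absorb all lower
    powers. *)
Lemma poly_growth q n : (size q <= n.+1)%N ->
  exists2 A : R, 0 <= A & forall (z : R[i]) (rho : R), 1 <= rho -> cmod z <= rho ->
    cmod q.[z] <= A * rho ^+ n.
Proof.
move=> sq; exists (\sum_(i < size q) cmod q`_i) => [|z rho r1 zr].
  by apply: sumr_ge0 => i _; exact: cmod_ge0.
rewrite horner_coef (le_trans (cmod_sum _ _ _)) // mulr_suml.
apply: ler_sum => i _; rewrite cmodM cmodX ler_wpM2l ?cmod_ge0 //.
have r0 : 0 <= rho by rewrite (le_trans ler01).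
apply: (@le_trans _ _ (rho ^+ i)).
  by rewrite lerXn2r ?nnegrE ?cmod_ge0.
by rewrite ler_weXn2l // -ltnS (leq_trans _ sq).
Qed.

End Holomorphy.

(** * The Hénon map, its polynomial inverse, its differential and its growth *)

Section Henon.
Variables (R : realType) (p : {poly R[i]}) (delta : R[i]).
Local Notation H := (henon p delta).

Definition henon_inv (y : C2 R) : C2 R := (y.2, (y.1 - p.[y.2]) / delta).

(** The Jacobian matrix of the Hénon map at [x], applied to [v]. *)
Definition henon_tangent (x v : C2 R) : C2 R :=
  (p^`().[x.1] * v.1 + delta * v.2, v.1).

Lemma is_diff_henon (x : C2 R) : is_diff x H (henon_tangent x).
Proof.
have h1 := @is_diff_horner _ _ p _ _ _ (is_diff_fst x).
have h2 := @is_diffZ _ _ _ _ _ (delta : CC R) x (is_diff_snd x).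
have h3 := @is_diffD _ _ _ _ _ _ _ x h1 h2.
exact: (@is_diff_pair _ _ _ _ _ _ _ _ x h3 (is_diff_fst x)).
Qed.

Lemma differentiable_henon (x : C2 R) : differentiable H x.
Proof. by have := is_diff_henon x => ?; exact: ex_diff. Qed.

Lemma diff_henon (x : C2 R) : 'd H x = henon_tangent x :> (C2 R -> C2 R).
Proof. by have := is_diff_henon x => ?; rewrite diff_val. Qed.

Lemma differentiable_henon_inv (y : C2 R) : differentiable henon_inv y.
Proof.
have d1 (z : C2 R) : differentiable (fun y : C2 R => y.1 : CC R) z.
  by have [] := is_diff_fst z.
have d2 (z : C2 R) : differentiable (fun y : C2 R => y.2 : CC R) z.
  by have [] := is_diff_snd z.
have d3 : differentiable (fun y : C2 R => p.[y.2] : CC R) y.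
  by have [] := @is_diff_horner _ _ p _ _ y (is_diff_snd y).
have d4 := @differentiableM _ _ _ _ y (differentiableB (d1 y) d3)
  (differentiable_cst (delta^-1 : CC R) y).
exact: (differentiable_pair (d2 y) d4).
Qed.

Lemma differentiable_iter (V : normedModType R[i]) (f : V -> V) n x :
  (forall y, differentiable f y) -> differentiable (iter n f) x.
Proof.
move=> df; elim: n => [|n IH]; first exact: ex_diff.
exact: (differentiable_comp IH).
Qed.

Lemma diff_iterS n (x v : C2 R) :
  'd (iter n.+1 H) x v = henon_tangent (iter n H x) ('d (iter n H) x v).
Proof.
have h : 'd (H \o iter n H) x = 'd H (iter n H x) \o 'd (iter n H) x
    :> (C2 R -> C2 R).
  apply: diff_comp; last exact: differentiable_henon.
  exact: differentiable_iter differentiable_henon.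
rewrite -(diff_henon (iter n H x)).
exact: (congr1 (@^~ v) h).
Qed.

Hypothesis delta0 : delta != 0.

Lemma henonK : cancel H henon_inv.
Proof.
by move=> [z w]; rewrite /henon_inv /henon /= addrAC subrr add0r mulrC mulKf.
Qed.

Lemma henon_invK : cancel henon_inv H.
Proof.
by move=> [z w]; rewrite /henon_inv /henon /= mulrC divfK // addrC subrK.
Qed.

Lemma iter_henonK n : cancel (iter n H) (iter n henon_inv).
Proof. by move=> x; elim: n x => [//|n IH] x; rewrite iterSr /= henonK IH. Qed.

Lemma iter_henon_invK n : cancel (iter n henon_inv) (iter n H).
Proof. by move=> x; elim: n x => [//|n IH] x; rewrite iterSr /= henon_invK IH. Qed.

(** Chain rule for the composite of H^n and H^-n, which is the identity. *)
Lemma diff_iter_inv n (x v : C2 R) :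
  'd (iter n henon_inv) (iter n H x) ('d (iter n H) x v) = v.
Proof.
have h := @diff_comp _ _ _ _ (iter n H) (iter n henon_inv) x
  (differentiable_iter n x differentiable_henon)
  (differentiable_iter n _ differentiable_henon_inv).
have := congr1 (@^~ v) h; rewrite /= => <-.
rewrite (_ : _ \o _ = id) ?diff_val //.
by apply/funext => y /=; rewrite iter_henonK.
Qed.

Lemma henon_growth d : (2 <= d)%N -> size p = d.+1 ->
  exists A : R, [/\ 1 <= A, cmod delta <= A,
    forall (z : R[i]) (rho : R), 1 <= rho -> cmod z <= rho ->
      cmod p.[z] <= A * rho ^+ d,
    forall (x : C2 R) (rho : R), 1 <= rho -> supn x <= rho ->
      supn (H x) <= A * rho ^+ d &
    forall (x v : C2 R) (rho : R), 1 <= rho -> supn x <= rho ->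
      supn (henon_tangent x v) <= A * rho ^+ d.-1 * supn v].
Proof.
move=> d2 sp; have [A A0 HA] := @poly_growth _ p d (eq_leq sp).
have [|B B0 HB] := @poly_growth _ p^`() d.-1.
  have pn0 : p != 0 by rewrite -size_poly_eq0 sp.
  have := lt_size_deriv pn0; rewrite sp ltnS prednK //.
  by rewrite (leq_trans _ d2).
have D0 := cmod_ge0 delta.
(* One constant serves all the bounds: [A] comes from p, [B] from its derivative, and the final 1
   makes it at least 1. *)
exists (A + B + cmod delta + 1); split; [lra|lra| | |].
- move=> z rho r1 zr; apply: le_trans (HA z rho r1 zr) _.
  by rewrite ler_wpM2r ?exprn_ge0 ?(le_trans ler01) //; lra.
- move=> x rho r1; rewrite supn_le => /andP[x1 x2].
  have r0 : 0 <= rho by rewrite (le_trans ler01).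
  have rd : rho <= rho ^+ d by rewrite ler_eXnr ?(leq_trans _ d2).
  have h0 : 0 <= rho ^+ d by rewrite exprn_ge0.
  have h1 := HA _ _ r1 x1.
  have h2 : cmod delta * cmod x.2 <= cmod delta * rho ^+ d.
    by rewrite ler_wpM2l // (le_trans x2).
  have h3 : 0 <= B * rho ^+ d by rewrite mulr_ge0.
  have h4 : 0 <= A * rho ^+ d by rewrite mulr_ge0.
  have h5 : 0 <= cmod delta * rho ^+ d by rewrite mulr_ge0.
  rewrite supn_le /=; apply/andP; split; last by lra.
  by apply: le_trans (cmodD _ _) _; rewrite cmodM; lra.
- move=> x v rho r1; rewrite supn_le => /andP[x1 x2].
  have r0 : 0 <= rho by rewrite (le_trans ler01).
  have v0 := supn_ge0 v; have v1 := cmod1_supn v; have v2 := cmod2_supn v.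
  have rd : 1 <= rho ^+ d.-1 by rewrite exprn_ege1.
  have h0 : 0 <= (rho ^+ d.-1 - 1) * supn v by rewrite mulr_ge0 ?subr_ge0.
  have h1 : cmod p^`().[x.1] * cmod v.1 <= B * rho ^+ d.-1 * supn v.
    by rewrite ler_pM ?cmod_ge0 // HB.
  have h2 : cmod delta * cmod v.2 <= cmod delta * supn v by rewrite ler_wpM2l.
  have h3 : 0 <= cmod delta * ((rho ^+ d.-1 - 1) * supn v) by rewrite mulr_ge0.
  have h4 : 0 <= A * (rho ^+ d.-1 * supn v) by rewrite !mulr_ge0 ?exprn_ge0.
  have h5 : 0 <= B * (rho ^+ d.-1 * supn v) by rewrite !mulr_ge0 ?exprn_ge0.
  rewrite supn_le /=; apply/andP; split; last by nra.
  by apply: le_trans (cmodD _ _) _; rewrite !cmodM; nra.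
Qed.

End Henon.

(** * The Green's function as a decreasing limit *)

Section Green.
Variables (R : realType) (d : nat) (p : {poly R[i]}) (delta : R[i]) (A : R).
Hypotheses (d2 : (2 <= d)%N) (sp : size p = d.+1) (A1 : 1 <= A).
Local Notation H := (henon p delta).
Hypothesis HA : forall (x : C2 R) (rho : R), 1 <= rho -> supn x <= rho ->
  supn (H x) <= A * rho ^+ d.

Let D : R := d%:R.

Let D2 : 2 <= D. Proof. by rewrite /D ler_nat. Qed.
Let Dgt0 : 0 < D. Proof. by have := D2; lra. Qed.

(* Chosen so that [upper_green] decreases: (ln A + c) / d = c. *)
Definition green_const : R := ln A / (d%:R - 1).

Lemma green_const_ge0 : 0 <= green_const.
Proof. by rewrite divr_ge0 ?ln_ge0 // -/D; have := D2; lra. Qed.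

(** Continuous approximants that decrease to the Green's function. Each one is an upper bound for
    it, so a strict inequality G x < r is witnessed at a finite n. *)
Definition upper_green (n : nat) (x : C2 R) : R :=
  (log_plus (supn (iter n H x)) + green_const) / d%:R ^+ n.

Lemma log_plus_henon (x : C2 R) :
  log_plus (supn (H x)) <= ln A + d%:R * log_plus (supn x).
Proof.
have A0 : 0 < A by rewrite (lt_le_trans ltr01).
rewrite log_plus_ler expRD lnK ?posrE // expRM_natl expR_log_plus.
set rho := Num.max 1 (supn x); have r1 : 1 <= rho by rewrite le_max lexx.
have rx : supn x <= rho by rewrite le_max lexx orbT.
by rewrite ge_max mulr_ege1 ?exprn_ege1 //= HA.
Qed.

Lemma upper_green_ge0 n x : 0 <= upper_green n x.
Proof.
rewrite divr_ge0 ?exprn_ge0 ?ler0n // addr_ge0 ?log_plus_ge0 //.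
exact: green_const_ge0.
Qed.

Lemma upper_green_nonincreasing x : nonincreasing_seq (upper_green ^~ x).
Proof.
apply/nonincreasing_seqP => n; rewrite /upper_green -/D.
rewrite ler_pdivrMr ?exprn_gt0 // exprS mulrCA divfK; last first.
  by rewrite expf_neq0 // gt_eqF.
have := log_plus_henon (iter n H x); rewrite -iterS -/D => h.
have c : green_const * (D - 1) = ln A.
  by rewrite /green_const divfK // -/D subr_eq0 gt_eqF //; have := D2; lra.
by lra.
Qed.

Lemma upper_green_cvg x : cvgn (upper_green ^~ x).
Proof.
apply: nonincreasing_is_cvgn; first exact: upper_green_nonincreasing.
by exists 0 => _ [n _ <-]; exact: upper_green_ge0.
Qed.

Lemma cvg_div_expn (c : R) : (c / D ^+ n) @[n --> \oo] --> (0 : R).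
Proof.
rewrite -[X in _ --> X](mulr0 c); apply: cvgMr => //.
rewrite (_ : (fun n => _) = (fun n => (D^-1) ^+ n)); last first.
  by apply/funext => n; rewrite exprVn.
apply: cvg_expr; rewrite ger0_norm ?invr_ge0 ?ltW // invf_lt1 //.
by have := D2; lra.
Qed.

(** Replacing the Euclidean norm by the sup norm and adding the constant changes the n-th term by
    O(1 / d^n). *)
Lemma henon_greenE x : henon_green p delta x = limn (upper_green ^~ x).
Proof.
rewrite /henon_green sp /=; apply: cvg_lim => //; rewrite -/D.
set l := limn _.
have h0 : (upper_green n x - (green_const + ln 2) / D ^+ n) @[n --> \oo] --> l.
  rewrite -[X in _ --> X]subr0; apply: cvgB; last exact: cvg_div_expn.
  exact: upper_green_cvg.
have h1 : (upper_green n x + (ln 2 - green_const) / D ^+ n) @[n --> \oo] --> l.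
  rewrite -[X in _ --> X]addr0; apply: cvgD; last exact: cvg_div_expn.
  exact: upper_green_cvg.
apply: squeeze_cvgr h0 h1; near=> n.
have l2 : 0 <= ln 2 :> R by rewrite ln_ge0 // ler1n.
rewrite /upper_green -/D -mulrBl -mulrDl !ler_pM2r ?invr_gt0 ?exprn_gt0 //.
set y := iter n H x; have := log_plus_homo (supn_enorm y).
have := log_plus_homo (enorm_supn y).
have := log_plusM (ler0n R 2) (supn_ge0 y).
rewrite [log_plus 2]log_plusE max_r ?ler1n //.
by move=> *; apply/andP; split; lra.
Unshelve. all: by end_near. Qed.

Lemma upper_green_to x : upper_green n x @[n --> \oo] --> henon_green p delta x.
Proof. by rewrite henon_greenE; exact: upper_green_cvg. Qed.

Lemma green_le_upper n x : henon_green p delta x <= upper_green n x.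
Proof.
rewrite henon_greenE; apply: nonincreasing_cvgn_ge.
  exact: upper_green_nonincreasing.
exact: upper_green_cvg.
Qed.

Lemma green_ge0 x : 0 <= henon_green p delta x.
Proof.
rewrite henon_greenE; apply: limr_ge; first exact: upper_green_cvg.
by near=> n; exact: upper_green_ge0.
Unshelve. all: by end_near. Qed.

Lemma green_lt_upper x r : henon_green p delta x < r ->
  \forall n \near \oo, upper_green n x < r.
Proof. by move=> xr; apply: (cvgr_lt _ (@upper_green_to x)). Qed.

Lemma green_henon x : henon_green p delta (H x) = d%:R * henon_green p delta x.
Proof.
have h : upper_green n (H x) @[n --> \oo] --> D * henon_green p delta x.
  rewrite (_ : (fun n => _) = (fun n => D * upper_green n.+1 x)).
    apply: cvgMr => //.
    have := @upper_green_to x; rewrite -cvg_shiftS; exact.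
  apply/funext => n; rewrite /upper_green -/D -iterSr exprS.
  by rewrite invfM mulrCA mulVKf // gt_eqF.
exact: (cvg_unique _ (@upper_green_to (H x)) h).
Qed.

Lemma supn_iter_continuous n : continuous (fun x : C2 R => supn (iter n H x)).
Proof.
move=> x; apply: (@continuous_comp _ _ _ (iter n H : C2 R -> C2 R) (@supn R));
  last exact: supn_continuous.
exact/differentiable_continuous/differentiable_iter/differentiable_henon.
Qed.

Lemma upper_green_continuous n : continuous (upper_green n).
Proof.
move=> x; apply: (@continuousM _ _ (fun x => log_plus (supn (iter n H x)) + green_const)
  (cst (d%:R ^+ n)^-1)); last exact: cvg_cst.
apply: (@continuousD _ _ _ (fun x => log_plus (supn (iter n H x))) (cst green_const));
  last exact: cvg_cst.
apply: (@continuous_comp _ _ _ (fun x => supn (iter n H x)) (@log_plus R)).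
  exact: supn_iter_continuous.
exact: log_plus_continuous.
Qed.

End Green.

(** * Plurisubharmonicity, openness of sublevel sets and non-constancy of the Green's function *)

Section Psh.
Variables (R : realType) (d : nat) (p : {poly R[i]}) (delta : R[i]) (A : R).
Hypotheses (d2 : (2 <= d)%N) (sp : size p = d.+1) (A1 : 1 <= A).
Local Notation H := (henon p delta).
Hypothesis HA : forall (x : C2 R) (rho : R), 1 <= rho -> supn x <= rho ->
  supn (H x) <= A * rho ^+ d.
Local Notation mu := (@lebesgue_measure R).
Local Notation U := (upper_green d p delta A).
Local Notation G := (henon_green p delta).

(** Along a complex line both coordinates of the iterate are polynomials in the parameter, so the
    submean inequality for polynomials applies. *)
Lemma iter_henon_line n (a b : C2 R) : exists P Q : {poly R[i]}, forall z : CC R,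
  iter n H (a + z *: b) = (P.[z], Q.[z]).
Proof.
elim: n => [|n [P [Q IH]]].
  exists (a.1%:P + b.1 *: 'X), (a.2%:P + b.2 *: 'X) => z.
  by rewrite /= !hornerD !hornerZ !hornerX !hornerC !(mulrC _ z).
exists (p \Po P + delta *: Q), P => z.
by rewrite iterS IH /henon /= hornerD hornerZ horner_comp.
Qed.

Let circle (a b : C2 R) (t : R) : C2 R := a + (expi t : CC R) *: b.

Let circle_continuous a b : continuous (circle a b).
Proof.
move=> t; apply: (@continuousD _ _ _ (cst a) (fun t => (expi t : CC R) *: b)).
  exact: cst_continuous.
have c : continuous (fun t : R => ((expi t : CC R) * b.1, (expi t : CC R) * b.2) : C2 R).
  apply: continuous_pair => s.
    apply: (@continuousM _ _ (@expi R : R -> CC R) (cst b.1)).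
      exact: expi_continuous.
    exact: cst_continuous.
  apply: (@continuousM _ _ (@expi R : R -> CC R) (cst b.2)).
    exact: expi_continuous.
  exact: cst_continuous.
exact: c.
Qed.

Let upper_circle_continuous n a b : continuous (fun t => U n (circle a b t)).
Proof.
move=> t; apply: (@continuous_comp _ _ _ (circle a b) (U n)).
  exact: circle_continuous.
exact: upper_green_continuous.
Qed.

Lemma log_supn_submean n (a b : C2 R) :
  log_plus (supn (iter n H a)) <=
  (2 * pi)^-1 * \int[mu]_(t in `[0, 2 * pi]) log_plus (supn (iter n H (circle a b t))).
Proof.
have [P [Q PQ]] := iter_henon_line n a b.
have pi2 : 0 < (2 * pi)^-1 :> R by rewrite invr_gt0 mulr_gt0 // pi_gt0.
have iE : iter n H a = (P.[0], Q.[0]) by rewrite -PQ scale0r addr0.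
have cs : continuous (fun t => log_plus (supn (iter n H (circle a b t)))).
  move=> t; apply: (@continuous_comp _ _ _ (fun t => supn (iter n H (circle a b t)))
    (@log_plus R)); last exact: log_plus_continuous.
  apply: (@continuous_comp _ _ _ (circle a b) (fun x => supn (iter n H x))).
    exact: circle_continuous.
  exact: supn_iter_continuous.
have key (S : {poly R[i]}) : (forall t : R, cmod S.[expi t] <= supn (iter n H (circle a b t))) ->
  log_plus (cmod S.[0]) <= (2 * pi)^-1 *
    \int[mu]_(t in `[0, 2 * pi]) log_plus (supn (iter n H (circle a b t))).
  move=> hS; apply: le_trans (submean_poly S) _; rewrite ler_pM2l //.
  apply: le_Rintegral => //.
  - by apply: continuous_itv_integrable; exact: log_plus_circle_continuous.
  - exact: continuous_itv_integrable.
  - by move=> t _; apply: log_plus_homo; exact: hS.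
(* The maximum at the centre is attained by one coordinate, whose modulus is at most the sup norm
   along the whole circle. *)
rewrite iE {1}/supn /=; case: (leP (cmod P.[0]) (cmod Q.[0])) => _; apply: key => t;
  rewrite /circle PQ.
  exact: (cmod2_supn (_, _)).
exact: (cmod1_supn (_, _)).
Qed.

Lemma upper_green_submean n (a b : C2 R) :
  U n a <= (2 * pi)^-1 * \int[mu]_(t in `[0, 2 * pi]) U n (circle a b t).
Proof.
have Dn : 0 < d%:R ^+ n :> R by rewrite exprn_gt0 // ltr0n (leq_trans _ d2).
pose L t := log_plus (supn (iter n H (circle a b t))).
have cL : continuous L.
  move=> t; apply: (@continuous_comp _ _ _ (fun t => supn (iter n H (circle a b t)))
    (@log_plus R)); last exact: log_plus_continuous.
  apply: (@continuous_comp _ _ _ (circle a b) (fun x => supn (iter n H x))).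
    exact: circle_continuous.
  exact: supn_iter_continuous.
have cc : continuous (cst (green_const d A) : R -> R) by exact: cst_continuous.
have iL := continuous_itv_integrable 0 (2 * pi) cL.
have ic := continuous_itv_integrable 0 (2 * pi) cc.
have cLc : continuous (L \+ cst (green_const d A)).
  by move=> t; apply: continuousD; [exact: cL|exact: cc].
have iLc := continuous_itv_integrable 0 (2 * pi) cLc.
rewrite /upper_green ler_pdivrMr // RintegralZr // mulrA divfK ?gt_eqF //.
rewrite RintegralD // mulrDr circle_mean_cst lerD2r.
exact: log_supn_submean.
Qed.

(** The submean inequality for [U n] passes to the limit by dominated convergence. *)
Lemma green_submean (a b : C2 R) :
  ((G a)%:E <= ((2 * pi)^-1)%:E *
    \int[mu]_(t in `[0%R, (2 * pi)%R]) (G (a + (expi t : CC R) *: b))%:E)%E.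
Proof.
have pi2 : 0 < (2 * pi)^-1 :> R by rewrite invr_gt0 mulr_gt0 // pi_gt0.
pose f_ (n : nat) (t : R) := (U n (circle a b t))%:E.
have iU n : mu.-integrable `[0, 2 * pi] (f_ n).
  by apply: continuous_itv_integrable; exact: upper_circle_continuous.
have mU n : measurable_fun (`[(0:R), (2 * pi : R)]%classic : set R) (fun t => U n (circle a b t)).
  by apply/measurable_EFinP; exact: (measurable_int mu (iU n)).
have mG : measurable_fun (`[(0:R), (2 * pi : R)]%classic : set R) (fun t => G (circle a b t)).
  apply: (measurable_fun_cvg mU) => t _; exact: upper_green_to.
have [] := @dominated_convergence _ _ _ mu (`[(0:R), (2 * pi : R)]%classic : set R) _ f_
  (fun t => (G (circle a b t))%:E) (f_ 0%N).
- by [].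
- by move=> n; exact: (measurable_int mu (iU n)).
- by apply/measurable_EFinP; exact: mG.
- apply: aeW => t _; apply: cvg_EFin; first by apply: nearW.
  exact: upper_green_to.
- exact: iU.
(* The approximants are non-negative and decrease in n, so the one of index 0 dominates them all. *)
- apply: aeW => t n _; rewrite /f_ /= lee_fin ger0_norm; last exact: upper_green_ge0.
  by apply: upper_green_nonincreasing.
move=> iG _ lim; set I := (\int[mu]_(t in _) _)%E.
have key n : ((G a)%:E <= ((2 * pi)^-1)%:E * \int[mu]_(t in `[0%R, (2 * pi)%R]) f_ n t)%E.
  rewrite -(fineK (integrable_fin_num _ (iU n))) // -EFinM lee_fin.
  by apply: le_trans (upper_green_submean n a b); exact: green_le_upper.
have lim' : (((2 * pi)^-1)%:E * \int[mu]_(t in `[0%R, (2 * pi)%R]) f_ n t)%E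
    @[n --> \oo] --> (((2 * pi)^-1)%:E * I)%E.
  by apply: cvgeZl.
rewrite -(cvg_lim _ lim') //; apply: lime_ge; first by apply/cvg_ex; exists (((2 * pi)^-1)%:E * I)%E.
by apply: nearW => n; exact: key.
Qed.

(** Upper semicontinuity holds because the Green's function is a pointwise infimum of continuous
    functions. *)
Lemma green_plurisubharmonic Omega :
  plurisubharmonic Omega (fun x => (G x)%:E).
Proof.
split=> [x _ //|x _ c|a b _]; last exact: green_submean.
rewrite lte_fin => /(green_lt_upper d2 sp A1 HA) [n _ /(_ _ (leqnn n)) /= Ux].
have : \forall y \near x, U n y < c.
  by apply: (cvgr_lt _ (@upper_green_continuous _ _ _ _ _ n x)).
apply: filterS => y Uy; rewrite lte_fin; apply: le_lt_trans Uy.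
exact: green_le_upper.
Qed.

Lemma green_open r : open [set x | G x < r].
Proof.
rewrite openE => x /= /(green_lt_upper d2 sp A1 HA) [n _ /(_ _ (leqnn n)) /= Ux].
have : \forall y \near x, U n y < r.
  by apply: (cvgr_lt _ (@upper_green_continuous _ _ _ _ _ n x)).
apply: filterS => y Uy /=; apply: le_lt_trans Uy; exact: green_le_upper.
Qed.

(** A fixed point of H satisfies G = d G, hence G = 0. Fixed points are the (z, z) with p(z) +
    (delta - 1) z = 0, an equation of degree d. *)
Lemma green_fixed_point : exists x : C2 R, G x = 0.
Proof.
pose q := p + (delta - 1) *: 'X.
have sq : size q = d.+1.
  rewrite /q size_polyDl sp // (leq_ltn_trans (size_scale_leq _ _)) //.
  by rewrite size_polyX.
have [z /rootP rz] : exists z, root q z.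
  apply/closed_rootP; rewrite sq; apply/eqP => -[d0]; move: d2; rewrite d0 //.
exists (z, z); have Hz : H (z, z) = (z, z).
  rewrite /henon /=; congr (_, _); move: rz.
  by rewrite /q hornerD hornerZ hornerX mulrBl mul1r addrA => /eqP; rewrite subr_eq0 => /eqP.
have := @green_henon _ _ _ _ _ d2 sp A1 HA (z, z); rewrite Hz => /eqP.
rewrite -subr_eq0 -{1}[G _]mul1r -mulrBl mulf_eq0 subr_eq0 => /orP[|/eqP //].
by rewrite eq_sym pnatr_eq1 => /eqP d1; move: d2; rewrite d1.
Qed.

(** In the region |z| >= rho, |w| <= |z| the leading term of p dominates; the region is mapped into
    itself and |z| grows at least like kappa |z|^d. *)
Lemma henon_expanding : exists rho kappa : R, [/\ 1 <= rho, 0 < kappa, kappa <= 1 &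
  forall x : C2 R, rho <= cmod x.1 -> cmod x.2 <= cmod x.1 ->
    [/\ kappa * cmod x.1 ^+ d <= cmod (H x).1, rho <= cmod (H x).1 &
        cmod (H x).2 <= cmod (H x).1]].
Proof.
pose l := lead_coef p; pose q := p - l *: 'X^d.
have p0 : p != 0 by rewrite -size_poly_eq0 sp.
have l0 : 0 < cmod l by rewrite lt_neqAle cmod_ge0 eq_sym cmod_eq0 lead_coef_eq0 p0.
have sq : (size q <= d)%N.
  apply/leq_sizeP => j; rewrite leq_eqVlt => /predU1P[<-|dj].
    by rewrite coefB coefZ coefXn eqxx mulr1 /l lead_coefE sp subrr.
  rewrite coefB coefZ coefXn gtn_eqF // mulr0 subr0 nth_default // sp //.
have [|B B0 HB] := @poly_growth _ q d.-1; first by rewrite prednK // (leq_trans _ d2).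
have D0 := cmod_ge0 delta.
(* For |z| >= rho, half the leading term is at least (B + |delta| + 1) |z|^(d-1). The first two
   summands absorb the lower terms of p and delta w; the 1 gives that |z| does not decrease. *)
pose rho := 1 + 2 * (B + cmod delta + 1) / cmod l.
have E0 : 0 <= 2 * (B + cmod delta + 1) / cmod l.
  by apply: divr_ge0; [lra|exact: ltW].
have rho1 : 1 <= rho by rewrite /rho; lra.
have rhol : 2 * (B + cmod delta + 1) <= rho * cmod l.
  by rewrite /rho [leRHS]mulrDl divfK ?gt_eqF // mul1r; lra.
exists rho, (Num.min 1 (cmod l / 2)); split=> //.
- by rewrite lt_min ltr01 divr_gt0.
- by rewrite ge_min lexx.
move=> [z w] /=; set m := cmod z => rz wz.
have m1 : 1 <= m by rewrite (le_trans rho1).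
have m0 : 0 <= m by rewrite (le_trans ler01).
pose t := m ^+ d.-1.
have tE : m ^+ d = m * t by rewrite /t -exprS prednK // (leq_trans _ d2).
have mt : m <= t by rewrite /t ler_eXnr // -subn1 subn_gt0.
have t0 : 0 <= t by rewrite (le_trans m0).
have h : cmod l * m ^+ d - (B * t + cmod delta * t) <= cmod (p.[z] + delta * w).
  have -> : p.[z] + delta * w = l * z ^+ d + (q.[z] + delta * w).
    by rewrite /q hornerD hornerN hornerZ hornerXn; ring.
  rewrite -cmodX -cmodM lerBlDr.
  have hq := HB z m m1 (lexx _); rewrite -/t in hq.
  have hw : cmod delta * cmod w <= cmod delta * t by rewrite ler_wpM2l // (le_trans wz).
  have := cmodB (l * z ^+ d + (q.[z] + delta * w)) (q.[z] + delta * w).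
  have := cmodD q.[z] (delta * w); rewrite cmodM addrK; lra.
have hl : (B + cmod delta + 1) * t <= cmod l / 2 * m ^+ d.
  rewrite tE mulrA ler_wpM2r //.
  have : rho * cmod l <= m * cmod l by rewrite ler_wpM2r // ltW.
  by lra.
have main : cmod l / 2 * m ^+ d <= cmod (p.[z] + delta * w) by nra.
have mm : m <= cmod (p.[z] + delta * w).
  have : 0 <= (B + cmod delta) * t by rewrite mulr_ge0 // addr_ge0.
  by nra.
split=> //; last exact: le_trans mm.
apply: le_trans main; rewrite ler_wpM2r ?exprn_ge0 //.
by rewrite ge_min lexx orbT.
Qed.

(** Along an orbit in the expanding region, ln |z_n| - c is multiplied by at least d at each step.
    Started at a value >= 1 it stays above d^n, which gives G >= 1. *)
Lemma green_pos : exists x : C2 R, 0 < G x.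
Proof.
have [rho [k [rho1 k0 k1 Hk]]] := henon_expanding.
have D2 : 2 <= d%:R :> R by rewrite ler_nat.
(* This c turns the inequality ln u' >= ln k + d ln u into ln u' - c >= d (ln u - c). *)
pose c := - ln k / (d%:R - 1).
have c0 : 0 <= c.
  by rewrite divr_ge0 ?oppr_ge0 ?ln_le0 // subr_ge0 (le_trans _ D2) // ler1n.
have cE : c * (d%:R - 1) = - ln k.
  by rewrite /c divfK // subr_eq0 gt_eqF // (lt_le_trans _ D2) // ltr1n.
(* The factor e^(c+1) makes the initial value of ln |z| - c at least 1. *)
pose m0 := rho * expR (c + 1).
have m01 : rho <= m0 by rewrite ler_peMr ?(le_trans ler01) // -expR0 ler_expR addr_ge0.
pose x : C2 R := (real_complex R m0, 0).
have rho0 : 0 < rho by rewrite (lt_le_trans ltr01).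
have xm : cmod x.1 = m0 by rewrite cmod_real ger0_norm // (le_trans _ m01) // ltW.
have inv n : [/\ rho <= cmod (iter n H x).1, cmod (iter n H x).2 <= cmod (iter n H x).1 &
    d%:R ^+ n <= ln (cmod (iter n H x).1) - c].
  elim: n => [|n [h1 h2 h3]].
    rewrite /= xm cmod0; split=> //; first by rewrite (le_trans _ m01) // ltW.
    rewrite expr0 lerBrDl /m0 lnM ?posrE ?expR_gt0 // expRK lerDr ln_ge0 //.
  have [g1 g2 g3] := Hk _ h1 h2; rewrite iterS; split=> //.
  move: g1 h1 h3; set u := cmod (iter n H x).1; set u' := cmod (H _).1 => g1 h1 h3.
  have u0 : 0 < u by rewrite (lt_le_trans rho0).
  have ku0 : 0 < k * u ^+ d by rewrite mulr_gt0 // exprn_gt0.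
  have : ln (k * u ^+ d) <= ln u'.
    by rewrite ler_ln ?posrE // (lt_le_trans ku0).
  rewrite lnM ?posrE ?exprn_gt0 // lnXn // -(mulr_natl (ln u)) exprS => h4.
  have : d%:R * d%:R ^+ n <= d%:R * (ln u - c) by rewrite ler_wpM2l.
  by lra.
exists x; apply: (@lt_le_trans _ _ 1) => //.
have := @upper_green_to _ _ _ _ _ d2 sp A1 HA x.
move=> /cvgP/limr_ge -/(_ 1); rewrite (henon_greenE d2 sp A1 HA); apply.
near=> n; have [h1 h2 h3] := inv n.
rewrite /upper_green ler_pdivlMr ?exprn_gt0 ?ltr0n ?(leq_trans _ d2) // mul1r.
have g0 := green_const_ge0 d2 A1.
have : ln (cmod (iter n H x).1) <= log_plus (supn (iter n H x)).
  by apply: le_trans (ln_le_log_plus _) _; apply: log_plus_homo; exact: cmod1_supn.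
by lra.
Unshelve. all: by end_near. Qed.

Hypothesis delta0 : delta != 0.

Lemma green_henon_inv n (x : C2 R) :
  G (iter n (henon_inv p delta) x) = G x / d%:R ^+ n.
Proof.
have D0 : d%:R != 0 :> R by rewrite pnatr_eq0 -lt0n (leq_trans _ d2).
elim: n => [|n IH]; first by rewrite expr0 divr1.
apply: (mulfI D0); rewrite -(green_henon d2 sp A1 HA) iterS henon_invK // IH.
by rewrite exprS invfM mulrCA mulVKf.
Qed.

(** A point with G > 0 is pulled back by H^-n, which divides G by d^n, until its value lies strictly
    between 0 and r; a fixed point has value 0. *)
Lemma green_nonconstant r : 0 < r -> exists x y, [/\ G x < r, G y < r & G x != G y].
Proof.
move=> r0; have [x x0] := green_fixed_point; have [y y0] := green_pos.
have : \forall n \near \oo, G y / d%:R ^+ n < r.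
  by apply: (cvgr_lt _ (@cvg_div_expn R d d2 (G y))).
case=> n _ /(_ _ (leqnn n)) /= h.
exists x, (iter n (henon_inv p delta) y); rewrite green_henon_inv x0; split=> //.
by rewrite eq_sym gt_eqF // divr_gt0 // exprn_gt0 // ltr0n (leq_trans _ d2).
Qed.

End Psh.

(** * Vanishing of the Kobayashi-Royden pseudometric on sublevel sets *)

Section Kobayashi.
Variables (R : realType) (d : nat) (p : {poly R[i]}) (delta : R[i]) (A : R).
Hypotheses (d2 : (2 <= d)%N) (sp : size p = d.+1) (A1 : 1 <= A).
Local Notation H := (henon p delta).
Local Notation Hinv := (henon_inv p delta).
Hypothesis HA : forall (x : C2 R) (rho : R), 1 <= rho -> supn x <= rho ->
  supn (H x) <= A * rho ^+ d.
Hypothesis HT : forall (x v : C2 R) (rho : R), 1 <= rho -> supn x <= rho ->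
  supn (henon_tangent p delta x v) <= A * rho ^+ d.-1 * supn v.
Hypothesis delta0 : delta != 0.
Local Notation U := (upper_green d p delta A).
Local Notation G := (henon_green p delta).
Local Notation c := (green_const d A).

Let D : R := d%:R.
Let D2 : 2 <= D. Proof. by rewrite /D ler_nat. Qed.
Let Dgt0 : 0 < D. Proof. by have := D2; lra. Qed.
Let Dn n : 0 < D ^+ n. Proof. by rewrite exprn_gt0. Qed.

Lemma upper_green_lt n x r :
  (U n x < r) = (Num.max 1 (supn (iter n H x)) < expR (d%:R ^+ n * r - c)).
Proof.
by rewrite -log_plus_ltr ltrBrDr /upper_green ltr_pdivrMr ?Dn // [r * _]mulrC.
Qed.

Lemma near_expn_gt (a e : R) : 0 < e -> \forall n \near \oo, a < d%:R ^+ n * e.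
Proof.
move=> e0; have : \forall n \near \oo, a / D ^+ n < e.
  by apply: (cvgr_lt _ (@cvg_div_expn R d d2 a)).
by apply: filterS => n; rewrite ltr_pdivrMr // mulrC.
Qed.

Lemma supn_iter_bound x s : G x < s ->
  \forall n \near \oo, Num.max 1 (supn (iter n H x)) <= expR (d%:R ^+ n * s).
Proof.
move=> /(green_lt_upper d2 sp A1 HA); apply: filterS => n.
rewrite upper_green_lt => /ltW h; apply: (le_trans h); rewrite ler_expR.
by rewrite gerBl green_const_ge0.
Qed.

(* The derivative of H^n along a bounded-height orbit grows at most like
   e^(d^n s), the same rate as the orbit itself. *)
Lemma diff_iter_bound x v s : G x < s -> exists2 Y : R, 0 <= Y &
  \forall n \near \oo, supn ('d (iter n H) x v) <= Y * expR (d%:R ^+ n * s).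
Proof.
(* The orbit is bounded at the smaller rate s', and the gap s - s' absorbs the factor A of each
   step. *)
move=> xs; pose s' := (G x + s) / 2.
have xs' : G x < s' by rewrite /s'; lra.
have s's : s' < s by rewrite /s'; lra.
have s0 : 0 <= s by rewrite (le_trans (green_ge0 d2 sp A1 HA x)) // ltW.
have e0 : 0 < (D - 1) * (s - s') by rewrite mulr_gt0 //; have := D2; lra.
have h1 := supn_iter_bound xs'.
have h2 := near_expn_gt (ln A) e0.
have [N _ HN] : \forall n \near \oo,
    Num.max 1 (supn (iter n H x)) <= expR (d%:R ^+ n * s') /\
    ln A < d%:R ^+ n * ((D - 1) * (s - s')).
  by near=> n; split; near: n.
pose V n := supn ('d (iter n H) x v).
exists (V N); first exact: supn_ge0.
exists N => //= n Nn.
rewrite -(subnK Nn); elim: (n - N)%N => [|k IH].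
  rewrite add0n; apply: ler_peMr; first exact: supn_ge0.
  by rewrite -expR0 ler_expR; apply: mulr_ge0 => //; exact: ltW (Dn N).
rewrite addSn; set m := (k + N)%N in IH *.
have [g1 g2] := HN m (leq_addl _ _).
rewrite diff_iterS; set w := 'd _ _ _ in IH *.
set M := expR (d%:R ^+ m * s') in g1.
have M1 : 1 <= M by apply: le_trans g1; rewrite le_max lexx.
have Mx : supn (iter m H x) <= M by apply: le_trans g1; rewrite le_max lexx orbT.
apply: le_trans (HT _ M1 Mx) _.
(* By the choice of N, ln A + (d - 1) d^m s' <= (d - 1) d^m s. Multiplying by the inductive bound
   e^(d^m s) then gives the exponent d^(m+1) s. *)
apply: (@le_trans _ _ (expR (d%:R ^+ m * ((D - 1) * s)) * supn w)).
  rewrite ler_wpM2r ?supn_ge0 //.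
  have A0 : 0 < A by rewrite (lt_le_trans ltr01).
  rewrite -[A in leLHS]lnK ?posrE // /M -expRM_natl -expRD ler_expR.
  have -> : (d.-1)%:R = D - 1 :> R.
    by rewrite /D -subn1 natrB // (leq_trans _ d2).
  move: g2; rewrite -/D; set t := D ^+ m; lra.
apply: (@le_trans _ _ (expR (d%:R ^+ m * ((D - 1) * s)) *
    (V N * expR (d%:R ^+ m * s)))).
  by rewrite ler_wpM2l ?expR_ge0.
rewrite mulrCA -expRD ler_wpM2l ?supn_ge0 // ler_expR exprS -/D.
by rewrite le_eqVlt; apply/orP; left; apply/eqP; ring.
Unshelve. all: by end_near. Qed.

(** The disc is z -> H^-n (H^n x + (z / a) D(H^n)_x v) with n large. Since [a] may be arbitrarily
    small, the pseudometric vanishes. *)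
Lemma kobayashi_disc r (x v : C2 R) (a : R) : G x < r -> 0 < a ->
  exists phi : CC R -> C2 R,
    [/\ holomorphic_on phi (@unit_disc R),
        (forall z, unit_disc z -> G (phi z) < r),
        phi 0 = x &
        'D_1 phi 0 = real_complex R a^-1 *: v].
Proof.
move=> xr a0; pose s := (G x + r) / 2.
have xs : G x < s by rewrite /s; lra.
have sr : s < r by rewrite /s; lra.
have [Y Y0 hY] := diff_iter_bound v xs.
have hM := supn_iter_bound xs.
have Ya : 0 <= Y / a by rewrite divr_ge0 // ltW.
have rs : 0 < r - s by rewrite subr_gt0.
(* For such n, the affine disc around H^n x has sup norm at most e^(d^n s) (1 + Y / a), which is
   below e^(d^n r - c). *)
have hn := near_expn_gt (ln (1 + Y / a) + c) rs.
have [n [g1 g2 g3]] : exists n : nat,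
    [/\ supn ('d (iter n H) x v) <= Y * expR (d%:R ^+ n * s),
        Num.max 1 (supn (iter n H x)) <= expR (d%:R ^+ n * s) &
        ln (1 + Y / a) + c < d%:R ^+ n * (r - s)].
  have : \forall n \near \oo,
    [/\ supn ('d (iter n H) x v) <= Y * expR (d%:R ^+ n * s),
        Num.max 1 (supn (iter n H x)) <= expR (d%:R ^+ n * s) &
        ln (1 + Y / a) + c < d%:R ^+ n * (r - s)].
    by near=> n; split; near: n.
  by case=> n _ /(_ _ (leqnn n)); exists n.
set M := expR _ in g1 g2.
pose q := iter n H x; pose w : C2 R := real_complex R a^-1 *: 'd (iter n H) x v.
have dl (z : CC R) : is_diff z (fun z : CC R => q + z *: w) (fun h : CC R => 0 + h *: w).
  exact: (@is_diffD _ _ _ _ _ _ _ z (@is_diff_cst _ _ _ q z) (is_diff_scalel z w)).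
have di (y : C2 R) : differentiable (iter n Hinv) y.
  exact/differentiable_iter/differentiable_henon_inv.
have dphi z : differentiable (iter n Hinv \o (fun z : CC R => q + z *: w)) z.
  by apply: differentiable_comp; [have [] := dl z|exact: di].
exists (iter n Hinv \o (fun z : CC R => q + z *: w)); split.
- by move=> z _; exact: dphi.
- move=> z z1; apply: le_lt_trans (green_le_upper d2 sp A1 HA n _) _.
  rewrite upper_green_lt /= iter_henon_invK //.
  have -> : d%:R ^+ n * r - c = d%:R ^+ n * s + (d%:R ^+ n * (r - s) - c) by ring.
  rewrite expRD -/M; apply: (@le_lt_trans _ _ (M * (1 + Y / a))); last first.
    rewrite ltr_pM2l ?expR_gt0 // -[ltLHS]lnK ?posrE ?ltr_expR; last by lra.
    by lra.
  have M1 : 1 <= M by apply: le_trans g2; rewrite le_max lexx.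
  have Mx : supn q <= M by apply: le_trans g2; rewrite le_max lexx orbT.
  have MY : 0 <= M * (Y / a) by rewrite mulr_ge0 ?expR_ge0.
  rewrite ge_max; apply/andP; split; first by lra.
  apply: le_trans (supnD _ _) _; rewrite supnZ /w supnZ cmod_real gtr0_norm ?invr_gt0 //.
  have : cmod z * (a^-1 * supn ('d (iter n H) x v)) <= 1 * (a^-1 * (Y * M)).
    apply: ler_pM; rewrite ?cmod_ge0 ?mulr_ge0 ?supn_ge0 ?invr_ge0 ?(ltW a0) //.
      exact: ltW.
    by rewrite ler_wpM2l // invr_ge0 ltW.
  by lra.
- by rewrite /= scale0r addr0 /q iter_henonK.
- rewrite deriveE; last exact: dphi.
  have h : 'd (iter n Hinv \o (fun z : CC R => q + z *: w)) (0 : CC R) =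
      'd (iter n Hinv) (q + (0 : CC R) *: w) \o 'd (fun z : CC R => q + z *: w) (0 : CC R)
      :> (CC R -> C2 R).
    by apply: diff_comp; [have [] := dl 0|exact: di].
  have -> := congr1 (@^~ (1 : CC R)) h.
  have e : 'd (fun z : CC R => q + z *: w) (0 : CC R) = (fun h : CC R => 0 + h *: w)
      :> (CC R -> C2 R) by have [] := dl 0.
  have -> : ('d (iter n Hinv) (q + (0 : CC R) *: w) \o
    'd (fun z : CC R => q + z *: w) (0 : CC R)) 1 = 'd (iter n Hinv) (q + (0 : CC R) *: w) w.
    have e1 := congr1 (@^~ (1 : CC R)) e; rewrite /= in e1.
    by rewrite /= e1 add0r scale1r.
  by rewrite scale0r addr0 /w linearZ /= /q diff_iter_inv.
Unshelve. all: by end_near. Qed.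

Lemma kobayashi_green r (x v : C2 R) : G x < r ->
  kobayashi_royden [set x : C2 R | G x < r] x v = 0%E.
Proof.
move=> xr; apply/eqP; rewrite eq_le; apply/andP; split; last first.
  by apply/ereal_infP => _ [a /= [a0 _] <-]; rewrite lee_fin ltW.
apply/lee_addgt0Pr => e e0; rewrite add0e; apply: ereal_inf_lbound.
by exists e => //=; split=> //; exact: kobayashi_disc.
Qed.

End Kobayashi.

(** * Concatenation of families over [0, 1] into one family over [0, +oo) *)

Section Glue.
Variables (R : realType) (T : topologicalType) (S : nat -> R -> set T).
Hypothesis Smono : forall n (u v : R), 0 <= u -> u < v -> v <= 1 ->
  closure (S n u) `<=` S n v.
Hypothesis Sleft : forall n (u : R) x, 0 < u -> u <= 1 -> S n u x ->
  exists2 v, 0 <= v < u & S n v x.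
Hypothesis Sright : forall n (u : R) x, 0 <= u -> u < 1 ->
  (forall v, u < v -> v <= 1 -> S n v x) -> closure (S n u) x.
Hypothesis Sglue : forall n, S n 1 = S n.+1 0.

Definition glue (t : R) : set T := S (Num.truncn t) (t - (Num.truncn t)%:R).

(** The right endpoint n + 1 is allowed as well, because the end of block n is the start of block n
    + 1. *)
Lemma glueE n (t : R) : n%:R <= t <= n.+1%:R -> glue t = S n (t - n%:R).
Proof.
case/andP => nt; rewrite le_eqVlt => /predU1P[->|tn].
  by rewrite /glue natrK subrr -Sglue -natr1 addrAC subrr add0r.
rewrite /glue; have -> : Num.truncn t = n; last by [].
by apply: truncn_def; rewrite nt.
Qed.

Let truncnP (t : R) : 0 <= t -> (Num.truncn t)%:R <= t < (Num.truncn t).+1%:R.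
Proof. exact: truncn_itv. Qed.

Let glue_nat n : glue n%:R = S n 0.
Proof. by rewrite (@glueE n) ?subrr // lexx ler_nat /=. Qed.

Lemma glue_nat_mono (m n : nat) : (m <= n)%N -> glue m%:R `<=` glue n%:R.
Proof.
elim: n => [|n IH]; first by rewrite leqn0 => /eqP ->.
rewrite leq_eqVlt => /predU1P[-> //|mn]; apply: (subset_trans (IH mn)).
rewrite !glue_nat -Sglue; apply: subset_trans (@subset_closure _ _) _.
exact: Smono.
Qed.

(** If s is beyond the block of t, the inclusion passes through the end of that block and then along
    integer times. *)
Lemma glue_closure_mono (t s : R) : 0 <= t -> t < s -> closure (glue t) `<=` glue s.
Proof.
move=> t0 ts; have s0 : 0 <= s by rewrite (le_trans t0) // ltW.
have /andP[nt tn] := truncnP t0; set n := Num.truncn t in nt tn.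
have tE : glue t = S n (t - n%:R) by apply: glueE; rewrite nt ltW.
have [sn|ns] := leP s n.+1%:R.
  rewrite tE (@glueE n s) ?sn ?(le_trans nt) ?ltW //.
  apply: Smono; first by rewrite subr_ge0.
    by rewrite ltrD2r.
  by rewrite lerBlDr addrC natr1.
have /andP[ms sm] := truncnP s0; set m := Num.truncn s in ms sm.
have nm : (n.+1 <= m)%N by rewrite -ltnS -(ltr_nat R) (lt_trans ns).
apply: (@subset_trans _ (glue n.+1%:R)).
  rewrite tE glue_nat -Sglue; apply: Smono => //; first by rewrite subr_ge0.
  by rewrite ltrBlDr addrC natr1.
apply: subset_trans (glue_nat_mono nm) _.
move: ms; rewrite le_eqVlt => /predU1P[<- //|ms].
rewrite glue_nat (@glueE m s) ?(ltW ms) ?ltW //.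
apply: subset_trans (@subset_closure _ _) _.
by apply: Smono => //; [rewrite subr_gt0|rewrite lerBlDr addrC natr1 ltW].
Qed.

Lemma glue_left (t : R) : 0 < t ->
  glue t = \bigcup_(s in [set s | 0 <= s /\ s < t]) glue s.
Proof.
move=> t0; apply/seteqP; split => [x tx|x [s [s0 st]] sx]; last first.
  by apply: (glue_closure_mono s0 st); exact: subset_closure.
(* An integer time t is viewed as the end of the preceding block, since left continuity within a
   block needs a positive local time. *)
have [n nt tn] : exists2 n : nat, n%:R < t & t <= n.+1%:R.
  have /andP[nt tn] := truncnP (ltW t0); move: nt tn; case: (Num.truncn t) => [|n] nt tn.
    by exists 0%N => //; rewrite ltW.
  move: nt; rewrite le_eqVlt => /predU1P[nt|nt].
    by exists n; rewrite -nt ?ltr_nat.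
  by exists n.+1 => //; rewrite ltW.
rewrite (@glueE n) ?(ltW nt) ?tn // in tx.
have [||v /andP[v0 vt] Sv] := Sleft _ _ tx; first by rewrite subr_gt0.
  by rewrite lerBlDr addrC natr1.
have vn1 : v + n%:R <= n.+1%:R.
  by apply: le_trans tn; rewrite -lerBrDr ltW.
exists (v + n%:R) => /=.
  by split; [rewrite addr_ge0 ?ler0n|rewrite -ltrBrDr].
by rewrite (@glueE n) ?addrK // vn1 lerDr v0.
Qed.

Lemma glue_right (t : R) : 0 <= t ->
  closure (glue t) = \bigcap_(s in [set s | t < s]) glue s.
Proof.
move=> t0; apply/seteqP; split => [x tx s /= ts|x H].
  exact: (glue_closure_mono t0 ts).
have /andP[nt tn] := truncnP t0; set n := Num.truncn t in nt tn.
rewrite (@glueE n) ?nt ?ltW //; apply: Sright; first by rewrite subr_ge0.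
  by rewrite ltrBlDr addrC natr1.
move=> v; rewrite ltrBlDr => tv v1; have := H _ tv; rewrite (@glueE n) ?addrK //.
by rewrite lerDr -natr1 addrC lerD2l v1 andbT -(lerD2r n%:R) add0r (le_trans nt) // ltW.
Qed.

Lemma bigcup_glue : \bigcup_(t in [set t : R | 0 <= t]) glue t = \bigcup_n S n 0.
Proof.
apply/seteqP; split => [x [t /= t0 tx]|x [n _ Sx]]; last first.
  by exists n%:R; rewrite /= ?ler0n ?glue_nat.
have /andP[_ tn] := truncnP t0; exists (Num.truncn t).+1 => //.
by rewrite -glue_nat; apply: (glue_closure_mono t0 tn); exact: subset_closure.
Qed.

End Glue.

(** * Domains obtained from balls and bidiscs by automorphisms of C^2 *)

Section Automorphism.
Variable R : realType.

Definition automorphism (F F' : C2 R -> C2 R) : Prop :=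
  [/\ forall x, differentiable F x, forall x, differentiable F' x,
      cancel F F' & cancel F' F].

Variables F F' : C2 R -> C2 R.
Hypothesis autF : automorphism F F'.

Let cF : continuous F.
Proof. by move=> x; apply: differentiable_continuous; case: autF. Qed.

Let cF' : continuous F'.
Proof. by move=> x; apply: differentiable_continuous; case: autF. Qed.

Lemma preimage_autE (B : set (C2 R)) : F' @^-1` B = F @` B.
Proof.
have [_ _ FK F'K] := autF; apply/seteqP; split => [x Bx|_ [y By <-]].
  by exists (F' x); rewrite ?F'K.
by rewrite /preimage /= FK.
Qed.

Lemma biholomorphic_preimage (B : set (C2 R)) : biholomorphic B (F' @^-1` B).
Proof.
have [dF dF' FK F'K] := autF; exists F, F'; split=> [x _|x _|x Bx|y By] //.
  by rewrite /preimage /= FK.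
Qed.

(** [N] is left general so as to cover both Euclidean balls and bidiscs; its unit ball is
    star-shaped about 0. *)
Lemma domain_preimage (N : C2 R -> R) : continuous N ->
  (forall k x, N (k *: x) = cmod k * N x) -> (forall x, 0 <= N x) ->
  domain (F' @^-1` [set x | N x < 1]).
Proof.
move=> cN NZ N0; split; last split.
- apply: open_comp => [x _|]; first exact: cF'.
  rewrite (_ : [set x | _] = N @^-1` [set t | t < 1]) //.
  by apply: open_comp => [x _|]; [exact: cN|exact: open_lt].
- rewrite preimage_autE; apply: connected_continuous_connected.
    apply: star_connected => x s /= Nx /andP[s0 s1].
    rewrite NZ cmod_real ger0_norm // (le_lt_trans _ Nx) //.
    by rewrite ler_piMl.
  exact: continuous_subspaceT.
- rewrite preimage_autE; exists (F 0), 0 => //=.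
  by rewrite -(scale0r 0) NZ cmod0 mul0r ltr01.
Qed.

Lemma compact_preimage : compact (F' @^-1` [set x | supn x <= 1]).
Proof.
rewrite preimage_autE; apply: continuous_compact; first exact: continuous_subspaceT.
exact: compact_supn_le.
Qed.

Lemma closure_preimage :
  closure (F' @^-1` [set x | supn x < 1]) = F' @^-1` [set x | supn x <= 1].
Proof.
apply/seteqP; split.
  rewrite closureE; apply: smallest_sub; last by move=> x /= /ltW.
  apply: closed_comp => [x _|]; first exact: cF'.
  rewrite (_ : [set x | _] = (@supn R) @^-1` [set t | t <= 1]) //.
  by apply: closed_comp => [x _|]; [exact: supn_continuous|exact: closed_le].
(* A point of the closed bidisc is approached radially in the chart: g(t) tends to x as t tends to 1
   and lies in the open preimage for 0 <= t < 1. *)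
move=> x /= Fx B Bx; pose g (t : R) : C2 R := F (real_complex R t *: F' x).
have [_ _ FK F'K] := autF.
have cg : continuous g.
  move=> t; apply: (@continuous_comp _ _ _ (fun t => real_complex R t *: F' x : C2 R) F);
    last exact: cF.
  have c : continuous (fun t : R =>
      ((real_complex R t : CC R) * (F' x).1, (real_complex R t : CC R) * (F' x).2) : C2 R).
    by apply: continuous_pair => s;
      (apply: continuousM; [exact: real_complex_continuous|exact: cst_continuous]).
  exact: c.
have g1 : g 1 = x by rewrite /g scale1r F'K.
have : \forall t \near (1 : R), B (g t) by apply: cg; rewrite g1.
move=> /nbhs_ballP[e /= e0 Be].
pose m := Num.min e 1; have m0 : 0 < m by rewrite lt_min e0 ltr01.
have me : m <= e by rewrite ge_min lexx.
have m1 : m <= 1 by rewrite ge_min lexx orbT.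
exists (g (1 - m / 2)); split; last first.
  by apply: Be; rewrite -ball_normE /= opprB addrCA subrr addr0 ger0_norm; lra.
rewrite /= /g FK supnZ cmod_real ger0_norm; last by lra.
apply: (@le_lt_trans _ _ ((1 - m / 2) * 1)); last by lra.
by rewrite ler_wpM2l //; lra.
Qed.

End Automorphism.

(** * The exhaustions of a sublevel set by balls and by a continuous family of polydiscs *)

Section HenonFamily.
Variables (R : realType) (p : {poly R[i]}) (delta : R[i]).
Hypothesis delta0 : delta != 0.
Local Notation H := (henon p delta).
Local Notation Hinv := (henon_inv p delta).

Lemma automorphism_comp (F F' E E' : C2 R -> C2 R) :
  automorphism F F' -> automorphism E E' -> automorphism (F \o E) (E' \o F').
Proof.
move=> [dF dF' FK F'K] [dE dE' EK E'K]; split=> [x|x||].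
- exact: (differentiable_comp (dE x) (dF _)).
- exact: (differentiable_comp (dF' x) (dE' _)).
- by move=> x /=; rewrite FK EK.
- by move=> x /=; rewrite E'K F'K.
Qed.

Lemma automorphism_iter_henon n : automorphism (iter n Hinv) (iter n H).
Proof.
split=> [x|x||].
- exact/differentiable_iter/differentiable_henon_inv.
- exact/differentiable_iter/differentiable_henon.
- exact: iter_henon_invK.
- exact: iter_henonK.
Qed.

Lemma differentiable_scale (k : R[i]) (x : C2 R) :
  differentiable (fun y : C2 R => k *: y) x.
Proof. by have [] := @is_diff_scaler _ _ k x. Qed.

Lemma automorphism_scale (k : R[i]) : k != 0 ->
  automorphism (fun y : C2 R => k *: y) (fun y : C2 R => k^-1 *: y).
Proof.
move=> k0; split=> [x|x||]; [exact: differentiable_scale..| |].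
- by move=> x; rewrite scalerA mulVf // scale1r.
- by move=> x; rewrite scalerA mulfV // scale1r.
Qed.

Definition shear (a b s : R[i]) (u : C2 R) : C2 R :=
  (a * u.1, (b * u.2 - s * p.[a * u.1]) / delta).

(** For positive real a and b, this chart carries {|z| < a, |s p(z) + delta w| < b} onto the unit
    bidisc. *)
Definition shear_inv (a b s : R[i]) (y : C2 R) : C2 R :=
  (y.1 / a, (s * p.[y.1] + delta * y.2) / b).

Lemma automorphism_shear (a b s : R[i]) : a != 0 -> b != 0 ->
  automorphism (shear a b s) (shear_inv a b s).
Proof.
move=> a0 b0.
have d1 (z : C2 R) : differentiable (fun y : C2 R => y.1 : CC R) z.
  by have [] := is_diff_fst z.
have d2 (z : C2 R) : differentiable (fun y : C2 R => y.2 : CC R) z.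
  by have [] := is_diff_snd z.
have dc (k : R[i]) (f : C2 R -> CC R) (z : C2 R) : differentiable f z ->
    differentiable (fun y => k * f y : CC R) z.
  by move=> df; exact: (@differentiableM _ _ _ _ z (differentiable_cst (k : CC R) z) df).
have dr (k : R[i]) (f : C2 R -> CC R) (z : C2 R) : differentiable f z ->
    differentiable (fun y => f y * k : CC R) z.
  by move=> df; exact: (@differentiableM _ _ _ _ z df (differentiable_cst (k : CC R) z)).
have dp (f : C2 R -> CC R) (z : C2 R) : differentiable f z ->
    differentiable (fun y => p.[f y] : CC R) z.
  move=> /differentiableP df.
  by have [] := @is_diff_horner _ _ p _ _ z df.
split=> [x|x|[u1 u2]|[y1 y2]].
- apply: differentiable_pair; first exact/dc/d1.
  apply: dr; apply: (@differentiableB _ _ _ (fun y : C2 R => b * y.2 : CC R)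
    (fun y : C2 R => s * p.[a * y.1] : CC R)); first exact/dc/d2.
  exact/dc/dp/dc/d1.
- apply: differentiable_pair; first exact/dr/d1.
  apply: dr; apply: (@differentiableD _ _ _ (fun y : C2 R => s * p.[y.1] : CC R)
    (fun y : C2 R => delta * y.2 : CC R)); last exact/dc/d2.
  exact/dc/dp/d1.
- rewrite /shear /shear_inv /=; congr (_, _); first by rewrite mulrAC divff ?mul1r.
  by rewrite [delta * _]mulrC divfK // addrC subrK mulrAC divff ?mul1r.
- rewrite /shear /shear_inv /=.
  have -> : a * (y1 / a) = y1 by rewrite mulrC divfK.
  have -> : b * ((s * p.[y1] + delta * y2) / b) = s * p.[y1] + delta * y2.
    by rewrite mulrC divfK.
  by congr (_, _); rewrite addrAC subrr add0r mulrC mulKf.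
Qed.

Lemma shear_inv_lt (a b : R) (s : R[i]) (y : C2 R) : 0 < a -> 0 < b ->
  (supn (shear_inv (real_complex R a) (real_complex R b) s y) < 1) =
  (cmod y.1 < a) && (cmod (s * p.[y.1] + delta * y.2) < b).
Proof.
move=> a0 b0; rewrite supn_lt /= !cmodM !cmodV !cmod_real !gtr0_norm //.
by rewrite !ltr_pdivrMr // !mul1r.
Qed.

Lemma shear_inv_le (a b : R) (s : R[i]) (y : C2 R) : 0 < a -> 0 < b ->
  (supn (shear_inv (real_complex R a) (real_complex R b) s y) <= 1) =
  (cmod y.1 <= a) && (cmod (s * p.[y.1] + delta * y.2) <= b).
Proof.
move=> a0 b0; rewrite supn_le /= !cmodM !cmodV !cmod_real !gtr0_norm //.
by rewrite !ler_pdivrMr // !mul1r.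
Qed.

Variables (d : nat) (A r C : R) (n0 : nat).
Hypotheses (d2 : (2 <= d)%N) (sp : size p = d.+1) (A1 : 1 <= A).
Hypothesis Adelta : cmod delta <= A.
Hypothesis Ap : forall (z : R[i]) (rho : R), 1 <= rho -> cmod z <= rho ->
  cmod p.[z] <= A * rho ^+ d.
Hypothesis HA : forall (x : C2 R) (rho : R), 1 <= rho -> supn x <= rho ->
  supn (H x) <= A * rho ^+ d.

Hypothesis HT : forall (x v : C2 R) (rho : R), 1 <= rho -> supn x <= rho ->
  supn (henon_tangent p delta x v) <= A * rho ^+ d.-1 * supn v.

(* Makes the next radius K rho^d exceed 2 rho, 2 A rho^d and the final radii of
   the first phase of [henon_polydisc]. *)
Local Notation K := (3 * A + A * 2 ^+ d + 2).
Hypothesis CE : C * (d%:R - 1) = ln K.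
Hypothesis n0P : C < d%:R ^+ n0 * r.
Hypothesis r0 : 0 < r.

(** The shift [n0] makes every radius exceed 1, and C (d - 1) = ln K gives the recursion rho_(k+1) =
    K rho_k^d. *)
Definition radius (k : nat) : R := expR (d%:R ^+ (k + n0) * r - C).

Lemma radius_gt1 k : 1 < radius k.
Proof.
rewrite /radius -[ltLHS]expR0 ltr_expR subr_gt0 (lt_le_trans n0P) // ler_pM2r //.
by rewrite ler_weXn2l ?leq_addl // ler1n (leq_trans _ d2).
Qed.

Let A2d : 0 < A * 2 ^+ d.
Proof. by rewrite mulr_gt0 ?exprn_gt0 // (lt_le_trans ltr01). Qed.

Lemma radiusS k : radius k.+1 = K * radius k ^+ d.
Proof.
have K0 : 0 < K by move: A2d A1; lra.
rewrite -[K in RHS]lnK ?posrE // -CE /radius -expRM_natl -expRD; congr expR.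
by rewrite addSn exprS; ring.
Qed.

Lemma radius_le_expn k : radius k <= radius k ^+ d.
Proof. by rewrite ler_eXnr ?(leq_trans _ d2) // ltW // radius_gt1. Qed.

(** Stated for any N between the sup norm and its double, so that it serves both the Euclidean balls
    and the bidiscs. *)
Lemma exhaustion (N : C2 R -> R) : (forall x, supn x <= N x <= 2 * supn x) ->
  [set x | henon_green p delta x < r] =
  \bigcup_k [set x | N (iter (k + n0) H x) < radius k].
Proof.
move=> hN; have D2 : 2 <= d%:R :> R by rewrite ler_nat.
(* Since K >= A, the radius e^(d^n r - C) is at most the threshold e^(d^n r - c) that characterises
   [upper_green] < r. *)
have Cc : green_const d A <= C.
  rewrite /green_const ler_pdivrMr; last by lra.
  have A0 : 0 < A by rewrite (lt_le_trans ltr01).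
  by rewrite CE ler_ln ?posrE //; move: A2d A1; lra.
apply/seteqP; split => [x /= xr|x [k _ /= xk]]; last first.
  apply: le_lt_trans (green_le_upper d2 sp A1 HA (k + n0)%N x) _.
  rewrite upper_green_lt //.
  have -> : expR (d%:R ^+ (k + n0) * r - green_const d A) =
      radius k * expR (C - green_const d A) by rewrite -expRD; congr expR; ring.
  apply: (@lt_le_trans _ _ (radius k)).
    rewrite gt_max radius_gt1 /=; case/andP: (hN (iter (k + n0) H x)) => h _.
    exact: le_lt_trans xk.
  by rewrite ler_peMr ?expR_ge0 // -[leLHS]expR0 ler_expR subr_ge0.
(* Conversely the orbit is eventually bounded by e^(d^n s), and the gap r - s eventually absorbs
   both C and the factor 2 from N. *)
pose s := (henon_green p delta x + r) / 2.
have xs : henon_green p delta x < s by rewrite /s; lra.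
have sr : 0 < r - s by rewrite /s; lra.
have h1 := supn_iter_bound d2 sp A1 HA xs.
have h2 := near_expn_gt d2 (C + ln 2) sr.
have [M _ HM] : \forall n \near \oo,
    Num.max 1 (supn (iter n H x)) <= expR (d%:R ^+ n * s) /\
    C + ln 2 < d%:R ^+ n * (r - s) by near=> n; split; near: n.
have [g1 g2] := HM _ (leq_addr n0 M); exists M => //=.
case/andP: (hN (iter (M + n0) H x)) => _ h; apply: (le_lt_trans h).
apply: (@le_lt_trans _ _ (2 * expR (d%:R ^+ (M + n0) * s))).
  by rewrite ler_pM2l // (le_trans _ g1) // le_max lexx orbT.
rewrite -[2 in ltLHS]lnK ?posrE // -expRD /radius ltr_expR.
move: g2; set t := d%:R ^+ _; lra.
Unshelve. all: by end_near. Qed.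

Lemma ball_chart (k : nat) : automorphism
  (iter (k + n0) Hinv \o (fun y : C2 R => real_complex R (radius k) *: y))
  ((fun y : C2 R => (real_complex R (radius k))^-1 *: y) \o iter (k + n0) H).
Proof.
apply: automorphism_comp; first exact: automorphism_iter_henon.
by apply: automorphism_scale; rewrite -cmod_eq0 cmod_real normr_eq0 gt_eqF ?expR_gt0.
Qed.

Definition henon_ball (k : nat) : set (C2 R) :=
  [set x | enorm (iter (k + n0) H x) < radius k].

Lemma henon_ballE k : henon_ball k =
  ((fun y : C2 R => (real_complex R (radius k))^-1 *: y) \o iter (k + n0) H)
    @^-1` (@unit_ball2 R).
Proof.
apply/seteqP; split => x; rewrite /henon_ball /unit_ball2 /preimage /= enormZ;
  by rewrite cmodV cmod_real gtr0_norm ?expR_gt0 // mulrC ltr_pdivrMr ?expR_gt0 // mul1r.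
Qed.

Lemma henon_ball_domain k : domain (henon_ball k).
Proof.
rewrite henon_ballE; apply: (domain_preimage (ball_chart k)).
- exact: enorm_continuous.
- exact: enormZ.
- exact: enorm_ge0.
Qed.

Lemma henon_ball_biholomorphic k : biholomorphic (@unit_ball2 R) (henon_ball k).
Proof. by rewrite henon_ballE; exact: (biholomorphic_preimage (ball_chart k)). Qed.

(** One more application of H sends the ball of radius rho into Euclidean norm at most 2 A rho^d,
    and 2 A < K. *)
Lemma henon_ballS k : henon_ball k `<=` henon_ball k.+1.
Proof.
rewrite /henon_ball => x /= /ltW xk; rewrite radiusS.
have r1 := ltW (radius_gt1 k).
apply: le_lt_trans (enorm_supn _) _.
have h := HA r1 (le_trans (supn_enorm _) xk).
have rd : 1 <= radius k ^+ d by rewrite exprn_ege1.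
have : 0 < (A + A * 2 ^+ d + 2) * radius k ^+ d.
  by rewrite mulr_gt0 ?(lt_le_trans ltr01) //; move: A2d A1; lra.
by move=> h2; lra.
Qed.

(** The clocks of the two phases: [ramp1] rises from 0 to 1 on [0, 1/2], [ramp2] on [1/2, 1]; each
    is constant on the other half of [0, 1]. *)
Let ramp1 (t : R) : R := Num.min (2 * t) 1.
Let ramp2 (t : R) : R := Num.max (2 * t - 1) 0.

(** A strict bound for |p(z)| on |z| <= 2 rho, the largest first radius in phase one; it is the rate
    at which the second radius must grow. *)
Let shift_bound k : R := A * (2 * radius k) ^+ d + 1.

(* The second polydisc radius first grows from |delta| rho, fast enough to absorb
   the term s p(z) while s goes from 0 to 1; then both radii grow to the next one. *)
Definition radius1 (k : nat) (t : R) : R :=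
  radius k * (1 + ramp1 t) + ramp2 t * (radius k.+1 - 2 * radius k).

Definition radius2 (k : nat) (t : R) : R :=
  cmod delta * radius k + ramp1 t * shift_bound k +
  ramp2 t * (radius k.+1 - (cmod delta * radius k + shift_bound k)).

(** In the coordinates (z, w) = H^(k + n0) x, the second condition moves from |delta w| to |p(z) +
    delta w|, the modulus of the first coordinate of H(z, w). *)
Definition henon_polydisc (k : nat) (t : R) : set (C2 R) :=
  [set x | cmod (iter (k + n0) H x).1 < radius1 k t /\
     cmod (real_complex R (ramp1 t) * p.[(iter (k + n0) H x).1] +
           delta * (iter (k + n0) H x).2) < radius2 k t].

Let gap1 k : 0 < radius k.+1 - 2 * radius k.
Proof.
rewrite radiusS; have := radius_le_expn k; have := radius_gt1 k.
set u := radius k; set v := u ^+ d => u1 uv.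
have : 0 <= (3 * A + A * 2 ^+ d) * v by rewrite mulr_ge0 //; move: A2d A1; lra.
have : 0 < A * v by rewrite mulr_gt0 //; move: A1; lra.
have : 0 <= (A - 1) * v by rewrite mulr_ge0 //; move: A1; lra.
by move: A2d A1; nra.
Qed.

Let gap2 k : 0 < radius k.+1 - (cmod delta * radius k + shift_bound k).
Proof.
rewrite radiusS /shift_bound exprMn; have := radius_le_expn k; have := radius_gt1 k.
set u := radius k; set v := u ^+ d => u1 uv.
have h1 : cmod delta * u <= A * v by rewrite ler_pM ?cmod_ge0 //; lra.
have h2 : 0 < A * v by rewrite mulr_gt0 //; move: A1; lra.
by set w := 2 ^+ d; lra.
Qed.

Let shift_bound_gt0 k : 0 < shift_bound k.
Proof.
by rewrite /shift_bound ltr_wpDl // mulr_ge0 ?exprn_ge0 ?mulr_ge0 ?expR_ge0 //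
  (le_trans ler01).
Qed.

Let ramp_itv t : 0 <= t -> t <= 1 -> [/\ 0 <= ramp1 t, ramp1 t <= 1 & 0 <= ramp2 t].
Proof.
move=> t0 t1; rewrite /ramp1 /ramp2 le_min ler01 andbT ge_min lexx orbT.
by rewrite le_max lexx orbT; split=> //; lra.
Qed.

Let ramp_lt t u : t < u ->
  (ramp1 t < ramp1 u /\ ramp2 t = 0 /\ 0 <= ramp2 u) \/
  (ramp1 t = ramp1 u /\ ramp2 t < ramp2 u).
Proof.
rewrite /ramp1 /ramp2 => tu; have [h|h] := ltP (2 * t) 1.
  left; split; last split.
  - by rewrite lt_min h andbT; lra.
  - by apply/max_idPr; lra.
  - by rewrite le_max lexx orbT.
right; rewrite (min_idPr _); last by lra.
split=> //; rewrite !(max_idPl _); lra.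
Qed.

Let radius1_gt0 k t : 0 <= t -> t <= 1 -> 0 < radius1 k t.
Proof.
move=> t0 t1; have [h1 h2 h3] := ramp_itv t0 t1.
have u0 := radius_gt1 k; have := mulr_ge0 h3 (ltW (gap1 k)).
have : 0 < radius k * (1 + ramp1 t) by rewrite mulr_gt0 //; lra.
by rewrite /radius1; lra.
Qed.

Let radius2_gt0 k t : 0 <= t -> t <= 1 -> 0 < radius2 k t.
Proof.
move=> t0 t1; have [h1 h2 h3] := ramp_itv t0 t1.
have := mulr_ge0 h3 (ltW (gap2 k)); have := mulr_ge0 h1 (ltW (shift_bound_gt0 k)).
have : 0 < cmod delta * radius k.
  by rewrite mulr_gt0 ?expR_gt0 // lt_neqAle cmod_ge0 eq_sym cmod_eq0 delta0.
by rewrite /radius2; lra.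
Qed.

Let chart k t (y : C2 R) : C2 R :=
  shear_inv (real_complex R (radius1 k t)) (real_complex R (radius2 k t))
    (real_complex R (ramp1 t)) (iter (k + n0) H y).

Let chart_inv k t : C2 R -> C2 R := iter (k + n0) Hinv \o
  shear (real_complex R (radius1 k t)) (real_complex R (radius2 k t))
    (real_complex R (ramp1 t)).

Let automorphism_chart k t : 0 <= t -> t <= 1 -> automorphism (chart_inv k t) (chart k t).
Proof.
move=> t0 t1; apply: automorphism_comp; first exact: automorphism_iter_henon.
by apply: automorphism_shear; rewrite -cmod_eq0 cmod_real normr_eq0 gt_eqF //;
  [exact: radius1_gt0|exact: radius2_gt0].
Qed.

Let henon_polydiscE k t : 0 <= t -> t <= 1 ->
  henon_polydisc k t = chart k t @^-1` [set y | supn y < 1].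
Proof.
move=> t0 t1; apply/seteqP; split => x /=; rewrite /chart shear_inv_lt;
  rewrite ?radius1_gt0 ?radius2_gt0 //.
  by case=> -> ->.
by case/andP.
Qed.

Let closure_henon_polydisc k t : 0 <= t -> t <= 1 ->
  closure (henon_polydisc k t) = [set x |
    cmod (iter (k + n0) H x).1 <= radius1 k t /\
    cmod (real_complex R (ramp1 t) * p.[(iter (k + n0) H x).1] +
           delta * (iter (k + n0) H x).2) <= radius2 k t].
Proof.
move=> t0 t1; rewrite henon_polydiscE // (closure_preimage (automorphism_chart k t0 t1)).
apply/seteqP; split => x /=; rewrite /chart shear_inv_le;
  rewrite ?radius1_gt0 ?radius2_gt0 //.
  by case/andP.
by case=> -> ->.
Qed.

Lemma henon_polydisc_domain k t : 0 <= t -> t <= 1 -> domain (henon_polydisc k t).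
Proof.
move=> t0 t1; rewrite henon_polydiscE //.
apply: (domain_preimage (automorphism_chart k t0 t1)).
- exact: supn_continuous.
- exact: supnZ.
- exact: supn_ge0.
Qed.

Lemma henon_polydisc_biholomorphic k t : 0 <= t -> t <= 1 ->
  biholomorphic (@unit_polydisc2 R) (henon_polydisc k t).
Proof.
move=> t0 t1; rewrite henon_polydiscE //.
rewrite (_ : [set y | supn y < 1] = @unit_polydisc2 R); last first.
  by apply/seteqP; split => x /=; rewrite supn_lt => /andP.
exact: (biholomorphic_preimage (automorphism_chart k t0 t1)).
Qed.

Lemma compact_closure_henon_polydisc k t : 0 <= t -> t <= 1 ->
  compact (closure (henon_polydisc k t)).
Proof.
move=> t0 t1; rewrite henon_polydiscE // (closure_preimage (automorphism_chart k t0 t1)).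
exact: (compact_preimage (automorphism_chart k t0 t1)).
Qed.

(** If t lies in the first phase, the change of shear from s to s' adds (s' - s) p(z), whose modulus
    is less than the growth of the second radius. Afterwards the shear is fixed and both radii grow
    strictly. *)
Lemma henon_polydisc_mono k t u : 0 <= t -> t < u -> u <= 1 ->
  closure (henon_polydisc k t) `<=` henon_polydisc k u.
Proof.
move=> t0 tu u1; have t1 : t <= 1 by rewrite ltW // (lt_le_trans tu).
rewrite closure_henon_polydisc // /henon_polydisc => x /=.
set y := iter _ _ _ => -[hz hw].
have g1 := gap1 k; have g2 := gap2 k; have q0 := radius_gt1 k.
have [h1 h2 h3] := ramp_itv t0 t1.
have [[s1 [s2 s3]]|[s1 s2]] := ramp_lt tu.
  move: hz hw; rewrite /radius1 /radius2 s2 !mul0r !addr0.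
  set s := ramp1 t in s1 h1 h2 *; set s' := ramp1 u in s1 *.
  move=> hz hw.
  have f1 := mulr_ge0 s3 (ltW g1); have f2 := mulr_ge0 s3 (ltW g2).
  have f3 : 0 < radius k * (s' - s) by rewrite mulr_gt0 ?subr_gt0 //; lra.
  have f4 : 0 <= radius k * (1 - s) by rewrite mulr_ge0 ?subr_ge0 //; lra.
  (* At time t the first radius is rho (1 + s) with s <= 1, hence |z| <= 2 rho. *)
  have pz : cmod p.[y.1] < shift_bound k.
    rewrite /shift_bound; apply: (@le_lt_trans _ _ (A * (2 * radius k) ^+ d)).
      by apply: Ap; lra.
    by rewrite ltrDl.
  split; first by lra.
  have -> : real_complex R s' * p.[y.1] + delta * y.2 =
     (real_complex R s * p.[y.1] + delta * y.2) + real_complex R (s' - s) * p.[y.1].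
    by rewrite rmorphB /=; ring.
  have : cmod (real_complex R (s' - s) * p.[y.1]) < (s' - s) * shift_bound k.
    by rewrite cmodM cmod_real gtr0_norm ?subr_gt0 // ltr_pM2l ?subr_gt0.
  have := cmodD (real_complex R s * p.[y.1] + delta * y.2)
    (real_complex R (s' - s) * p.[y.1]).
  by lra.
move: hz hw; rewrite /radius1 /radius2 s1 => hz hw.
have f1 : 0 < (ramp2 u - ramp2 t) * (radius k.+1 - 2 * radius k).
  by rewrite mulr_gt0 ?subr_gt0 //; lra.
have f2 : 0 < (ramp2 u - ramp2 t) *
    (radius k.+1 - (cmod delta * radius k + shift_bound k)).
  by rewrite mulr_gt0 ?subr_gt0 //; lra.
by split; [apply: (le_lt_trans hz)|apply: (le_lt_trans hw)]; lra.
Qed.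

Let ramp1_continuous : continuous ramp1.
Proof.
move=> t; rewrite (_ : ramp1 = (fun t : R => 2 * t) \min cst 1) //.
apply: continuous_min.
  by apply: continuousM; [exact: cst_continuous|exact: cvg_id].
exact: cst_continuous.
Qed.

Let ramp2_continuous : continuous ramp2.
Proof.
move=> t; rewrite (_ : ramp2 = (fun t : R => 2 * t - 1) \max cst 0) //.
apply: continuous_max.
  apply: continuousB; last exact: cst_continuous.
  by apply: continuousM; [exact: cst_continuous|exact: cvg_id].
exact: cst_continuous.
Qed.

Let radius1_continuous k : continuous (radius1 k).
Proof.
move=> t; apply: (@continuousD _ _ _ (fun t => radius k * (1 + ramp1 t))
  (fun t => ramp2 t * (radius k.+1 - 2 * radius k))).
  apply: (@continuousM _ _ (cst (radius k)) (fun t => 1 + ramp1 t)).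
    exact: cst_continuous.
  by apply: (@continuousD _ _ _ (cst (1 : R)) ramp1); [exact: cst_continuous|exact: ramp1_continuous].
by apply: (@continuousM _ _ ramp2 (cst _)); [exact: ramp2_continuous|exact: cst_continuous].
Qed.

Let radius2_continuous k : continuous (radius2 k).
Proof.
move=> t; apply: (@continuousD _ _ _ (fun t => cmod delta * radius k + ramp1 t * shift_bound k)
  (fun t => ramp2 t * (radius k.+1 - (cmod delta * radius k + shift_bound k)))).
  apply: (@continuousD _ _ _ (cst (cmod delta * radius k)) (fun t => ramp1 t * shift_bound k)).
    exact: cst_continuous.
  by apply: (@continuousM _ _ ramp1 (cst _)); [exact: ramp1_continuous|exact: cst_continuous].
by apply: (@continuousM _ _ ramp2 (cst _)); [exact: ramp2_continuous|exact: cst_continuous].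
Qed.

Let shear_continuous (P Q : R[i]) :
  continuous (fun t => cmod (real_complex R (ramp1 t) * P + Q)).
Proof.
move=> t; apply: (@continuous_comp _ _ _ (fun t => real_complex R (ramp1 t) * P + Q : CC R)
  (@cmod R)); last exact: cmod_continuous.
apply: (@continuousD _ _ _ (fun t => real_complex R (ramp1 t) * P : CC R) (cst (Q : CC R)));
  last exact: cst_continuous.
apply: (@continuousM _ _ (fun t => real_complex R (ramp1 t) : CC R) (cst (P : CC R)));
  last exact: cst_continuous.
apply: (@continuous_comp _ _ _ ramp1 (real_complex R : R -> CC R)).
  exact: ramp1_continuous.
exact: real_complex_continuous.
Qed.

Let margin1_continuous k (y : C2 R) : continuous (fun t => radius1 k t - cmod y.1).
Proof.
move=> t; apply: (@continuousB _ _ _ (radius1 k) (cst (cmod y.1))).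
  exact: radius1_continuous.
exact: cst_continuous.
Qed.

Let margin2_continuous k (y : C2 R) : continuous (fun t =>
  radius2 k t - cmod (real_complex R (ramp1 t) * p.[y.1] + delta * y.2)).
Proof.
move=> t; apply: (@continuousB _ _ _ (radius2 k)
  (fun t => cmod (real_complex R (ramp1 t) * p.[y.1] + delta * y.2))).
  exact: radius2_continuous.
exact: shear_continuous.
Qed.

Let near_left (P : set R) (t : R) : 0 < t -> (\forall u \near t, P u) ->
  exists2 v, 0 <= v < t & P v.
Proof.
move=> t0 /nbhs_ballP[e /= e0 Pe].
pose m := Num.min e t; have m0 : 0 < m by rewrite lt_min e0 t0.
have me : m <= e by rewrite ge_min lexx.
have mt : m <= t by rewrite ge_min lexx orbT.
exists (t - m / 2); first by apply/andP; split; lra.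
by apply: Pe; rewrite -ball_normE /= opprB addrCA subrr addr0 ger0_norm; lra.
Qed.

Let near_right (P : set R) (t : R) : t < 1 -> (\forall u \near t, P u) ->
  exists2 v, t < v <= 1 & P v.
Proof.
move=> t1 /nbhs_ballP[e /= e0 Pe].
pose m := Num.min e (1 - t); have m0 : 0 < m by rewrite lt_min e0 subr_gt0.
have me : m <= e by rewrite ge_min lexx.
have mt : m <= 1 - t by rewrite ge_min lexx orbT.
exists (t + m / 2); first by apply/andP; split; lra.
by apply: Pe; rewrite -ball_normE /= opprD addrA subrr add0r normrN ger0_norm; lra.
Qed.

(** For fixed x both margins, radius minus modulus, are continuous in t, so their positivity at t
    persists slightly before t. *)
Lemma henon_polydisc_left k t x : 0 < t -> t <= 1 -> henon_polydisc k t x ->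
  exists2 v, 0 <= v < t & henon_polydisc k v x.
Proof.
rewrite /henon_polydisc /=; set y := iter _ _ _ => t0 t1 [hz hw].
rewrite -subr_gt0 in hz; rewrite -subr_gt0 in hw.
have n1 := cvgr_gt _ (@margin1_continuous k y t) _ hz.
have n2 := cvgr_gt _ (@margin2_continuous k y t) _ hw.
have [v vt [v1 v2]] := near_left t0 (filterI (n1 _) (n2 _)).
by exists v => //; split; rewrite -subr_gt0.
Qed.

(** The closure is given by the non-strict inequalities. If one failed at t, its margin would stay
    negative at some v > t, contrary to membership at v. *)
Lemma henon_polydisc_right k t x : 0 <= t -> t < 1 ->
  (forall v, t < v -> v <= 1 -> henon_polydisc k v x) ->
  closure (henon_polydisc k t) x.
Proof.
move=> t0 t1; rewrite closure_henon_polydisc ?(ltW t1) // /henon_polydisc /=.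
set y := iter _ _ _ => Hv; split; rewrite leNgt -subr_lt0; apply/negP => h.
  have [v /andP[tv v1] /=] := near_right t1 (cvgr_lt _ (@margin1_continuous k y t) _ h).
  by have [] := Hv v tv v1; rewrite subr_lt0 => /lt_trans q _ /q; rewrite ltxx.
have [v /andP[tv v1] /=] := near_right t1 (cvgr_lt _ (@margin2_continuous k y t) _ h).
by have [_] := Hv v tv v1; rewrite subr_lt0 => /lt_trans q /q; rewrite ltxx.
Qed.

Lemma henon_polydisc0 k :
  henon_polydisc k 0 = [set x | supn (iter (k + n0) H x) < radius k].
Proof.
have e1 : ramp1 0 = 0 by rewrite /ramp1 mulr0 min_l.
have e2 : ramp2 0 = 0 by rewrite /ramp2 mulr0 sub0r max_r // lerN10.
rewrite /henon_polydisc /radius1 /radius2 e1 e2 !mul0r !addr0 mulr1.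
have D0 : 0 < cmod delta by rewrite lt_neqAle cmod_ge0 eq_sym cmod_eq0 delta0.
apply/seteqP; split => x /=; rewrite supn_lt !mul0r add0r cmodM ltr_pM2l //.
  by case=> -> ->.
by case/andP.
Qed.

(** At t = 1 both radii equal rho_(k+1) and the conditions bound z and p(z) + delta w, which are the
    two coordinates of H(z, w). *)
Lemma henon_polydisc1 k : henon_polydisc k 1 = henon_polydisc k.+1 0.
Proof.
rewrite henon_polydisc0.
have e1 : ramp1 1 = 1 by rewrite /ramp1 mulr1 min_r // ler1n.
have e2 : ramp2 1 = 1 by rewrite /ramp2 max_l; lra.
have r1 : radius1 k 1 = radius k.+1 by rewrite /radius1 e1 e2; ring.
have r2 : radius2 k 1 = radius k.+1 by rewrite /radius2 e1 e2; ring.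
rewrite /henon_polydisc r1 r2 e1.
apply/seteqP; split => x /=; rewrite supn_lt /= mul1r.
  by case=> -> ->.
by case/andP.
Qed.

Lemma short_green : short_C2 [set x | henon_green p delta x < r].
Proof.
have exh : [set x | henon_green p delta x < r] = \bigcup_k henon_ball k.
  by apply: exhaustion => x; rewrite supn_enorm enorm_supn.
(* All balls contain the smallest one, so they share a point and their union is connected. *)
have ball0 k : henon_ball 0 `<=` henon_ball k.
  by elim: k => [//|k IH]; apply: (subset_trans IH); exact: henon_ballS.
have [_ [_ [x0 Bx0]]] := henon_ball_domain 0.
split.
- split; first exact: (green_open d2 sp A1 HA).
  split; last by rewrite exh; exists x0; exists 0%N.
  rewrite exh; apply: bigcup_connected.
    by exists x0 => k _; exact: ball0.
  by move=> k _; have [_ []] := henon_ball_domain k.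
- exists henon_ball; split=> // k; last exact: henon_ballS.
  by split; [exact: henon_ball_domain|exact: henon_ball_biholomorphic].
- by move=> x v xr; exact: (kobayashi_green d2 sp A1 HA HT delta0).
- exists (fun x => (henon_green p delta x)%:E); split.
  + exact: (green_plurisubharmonic d2 sp A1 HA).
  + by exists r => x /= /ltW; rewrite lee_fin.
  + by have [x [y [xr yr xy]]] := green_nonconstant d2 sp A1 HA delta0 r0; exists x, y.
Qed.

Lemma loewner_green : loewner_short_C2 [set x | henon_green p delta x < r].
Proof.
split; first exact: short_green.
have mono := henon_polydisc_mono; have left := henon_polydisc_left.
have right := henon_polydisc_right; have step := henon_polydisc1.
have unit_itv (t : R) : 0 <= t ->
    0 <= t - (Num.truncn t)%:R /\ t - (Num.truncn t)%:R <= 1.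
  move=> t0; have /andP[h1 h2] := truncn_itv t0; split; first by rewrite subr_ge0.
  by rewrite lerBlDr addrC natr1 ltW.
exists (glue henon_polydisc); split.
- split; last split.
  + rewrite (bigcup_glue mono step) (@exhaustion (@supn R)); last first.
      by move=> x; rewrite lexx ler_peMl ?supn_ge0 // ler1n.
    by apply: eq_bigcupr => k _; rewrite henon_polydisc0.
  + by move=> t /unit_itv[h1 h2]; exact: henon_polydisc_domain.
  + by right => t /unit_itv[h1 h2]; exact: henon_polydisc_biholomorphic.
- move=> t s t0 ts; split; last exact: (glue_closure_mono mono step).
  by have [h1 h2] := unit_itv t t0; exact: compact_closure_henon_polydisc.
- by move=> t t0; exact: (glue_left mono left step).
- by move=> t t0; exact: (glue_right mono right step).
Qed.

End HenonFamily.

(** * Choice of the constants and conclusion *)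

Unset Implicit Arguments.

Theorem theorem1p5 (R : realType) (d : nat) (p : {poly R[i]}) (delta : R[i]) :
  (2 <= d)%N -> size p = d.+1 -> delta != 0 ->
  forall r : R, 0 < r ->
    loewner_short_C2 [set x : C2 R | henon_green p delta x < r].
Proof.
move=> d2 sp delta0 r r0.
have [A [A1 Adelta Ap HA HT]] := henon_growth delta d2 sp.
(* The solution of C (d - 1) = ln K, where K is the factor in the recursion of the radii. *)
pose C := ln (3 * A + A * 2 ^+ d + 2) / (d%:R - 1).
have D2 : 2 <= d%:R :> R by rewrite ler_nat.
have CE : C * (d%:R - 1) = ln (3 * A + A * 2 ^+ d + 2).
  by rewrite /C divfK // subr_eq0 gt_eqF // (lt_le_trans _ D2) // ltr1n.
(* The starting index is taken so large that d^n0 r > C, that is, the first radius exceeds 1. *)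
have [n0 _ /(_ _ (leqnn n0)) /= n0P] := near_expn_gt d2 C r0.
exact: (loewner_green delta0 d2 sp A1 Adelta Ap HA HT CE n0P r0).
Qed.
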